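(* Fix a positive even integer $d=2e$, and equip $\mathbb Q$ with the $2$-adic valuation. Let $I=\langle f,g\rangle\subseteq\mathbb Q[x_1,x_2,x_3]$, where $f$ and $g$ are two generic homogeneous polynomials of degree $d$ such that every coefficient of $f$ except that of $x_1^d$ and every coefficient of $g$ except that of $x_2^ex_3^e$ has positive $2$-adic valuation, and the remaining two coefficients (of $x_1^d$ in $f$ and of $x_2^ex_3^e$ in $g$) have $2$-adic valuation zero. (Generic means: there is a nonempty Zariski-open subset $U$ of the parameter space $\mathbb P^{\binom{d+2}{2}-1}\times\mathbb P^{\binom{d+2}{2}-1}$ over $\mathbb Q$ of pairs of degree-$d$ forms such that the assertion holds for all pairs $(f,g)\in U$ satisfying the stated valuation conditions.) Then $$\mathrm{in}_0(I)=\langle x_1^d,\ x_2^ex_3^e\rangle\subseteq(\mathbb Z/2\mathbb Z)[x_1,x_2,x_3]$$ with respect to the $2$-adic valuation, but for every monomial term order $\prec$ the standard initial ideal $\mathrm{in}_\prec(I)\subseteq\mathbb Q[x_1,x_2,x_3]$ has at least $\frac12(d+3)$ minimal generators.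
   Context: For nonzero $f=\sum c_ux^u\in\mathbb Q[x_1,x_2,x_3]$, with $\mathrm{val}$ the $2$-adic valuation, let $W=\min\{\mathrm{val}(c_u):c_u\ne 0\}$ and $$\mathrm{in}_0(f)=\sum_{\mathrm{val}(c_u)=W}\overline{2^{-\mathrm{val}(c_u)}c_u}\,x^u\in(\mathbb Z/2\mathbb Z)[x_1,x_2,x_3],$$ where $\overline a$ is the residue modulo $2$ of a rational number $a$ with nonnegative $2$-adic valuation. This is the initial form with respect to the weight vector $w=0$. For a homogeneous ideal $I$, $\mathrm{in}_0(I)=\langle\mathrm{in}_0(f):f\in I\setminus\{0\}\rangle$. The standard initial ideal $\mathrm{in}_\prec(I)$ is the usual monomial ideal of leading terms with respect to $\prec$, ignoring valuations. *)

(* Defs.v *)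
From mathcomp Require Import all_boot all_order all_algebra.
From mathcomp.multinomials Require Import mpoly.

Set Implicit Arguments.
Unset Strict Implicit.
Unset Printing Implicit Defensive.

Import Order.TTheory GRing.Theory Num.Theory.
Local Open Scope ring_scope.

Definition i1 : 'I_3 := @Ordinal 3 0 isT.
Definition i2 : 'I_3 := @Ordinal 3 1 isT.
Definition i3 : 'I_3 := @Ordinal 3 2 isT.

Definition ideal_gen (R : comNzRingType) (S : R -> Prop) (p : R) : Prop :=
  exists s : seq (R * R),
    (forall h, h \in s -> S h.2) /\ p = \sum_(h <- s) h.1 * h.2.

(* 2-adic valuation of a nonzero rational; the value at 0, where the valuation
   is +oo, is junk (it is 0), so every use below treats 0 separately. *)
Definition val2 (c : rat) : int :=
  (logn 2 `|numq c|)%:Z - (logn 2 `|denq c|)%:Z.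

Definition val2_pos (c : rat) : Prop := c != 0 -> 0 < val2 c.

Definition val2_zero (c : rat) : Prop := c != 0 /\ val2 c = 0.

(* Residue modulo 2 of a rational of nonnegative 2-adic valuation: its reduced
   denominator is odd, hence invertible in 'F_2. *)
Definition residue2 (c : rat) : 'F_2 := (numq c)%:~R / (denq c)%:~R.

(* The default value of the minimum is itself one of the valuations being
   minimized as soon as f != 0. *)
Definition min_val2 n (f : {mpoly rat[n]}) : int :=
  \big[Num.min/val2 (mleadc f)]_(m <- msupp f) val2 f@_m.

Definition in0 n (f : {mpoly rat[n]}) : {mpoly 'F_2[n]} :=
  \sum_(m <- msupp f | val2 f@_m == min_val2 f)
    residue2 (2%:R ^ (- val2 f@_m) * f@_m) *: 'X_[m].

Definition in0_ideal n (I : {mpoly rat[n]} -> Prop) : {mpoly 'F_2[n]} -> Prop :=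
  ideal_gen (fun q => exists f, [/\ I f, f != 0 & q = in0 f]).

Definition monomial_order n (le : rel 'X_{1..n}) : Prop :=
  [/\ total le, antisymmetric le, transitive le,
      forall m, le 0%MM m
    & forall m m1 m2, le m1 m2 -> le (m1 + m)%MM (m2 + m)%MM].

Definition lead_monomial (F : fieldType) n (le : rel 'X_{1..n})
    (f : {mpoly F[n]}) (m : 'X_{1..n}) : Prop :=
  m \in msupp f /\ {in msupp f, forall m', le m' m}.

Definition initial_ideal (F : fieldType) n (le : rel 'X_{1..n})
    (I : {mpoly F[n]} -> Prop) : {mpoly F[n]} -> Prop :=
  ideal_gen (fun q => exists f m,
    [/\ I f, lead_monomial le f m & q = f@_m *: 'X_[m]]).

Definition monomial_ideal (F : fieldType) n (s : seq 'X_{1..n}) :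
    {mpoly F[n]} -> Prop :=
  ideal_gen (fun q => exists2 m, m \in s & q = 'X_[m]).
Arguments monomial_ideal F {n} s _.

(* s lists, without repetition, an irredundant set of monomial generators of J;
   for a monomial ideal J this set is unique. *)
Definition minimal_generators (F : fieldType) n (J : {mpoly F[n]} -> Prop)
    (s : seq 'X_{1..n}) : Prop :=
  [/\ uniq s,
      forall p, J p <-> monomial_ideal F s p
    & {in s, forall m, ~ (forall p, J p <-> monomial_ideal F (rem m s) p)}].

(* Points of the projective space of forms of degree d are represented by
   nonzero forms; bihomogeneous equations do not see the scaling. *)
Definition is_form d (f : {mpoly rat[3]}) : Prop := f != 0 /\ f \is d.-homog.

Definition dmonom d := {m : 'X_{1..3 < d.+1} | mdeg m == d}.

Notation ncoef d := #|{: dmonom d}|.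

Lemma ncoefE d : ncoef d = 'C(d + 2, 2).
Proof.
have <- : 'C(d + 2, d) = 'C(d + 2, 2) by rewrite -bin_sub ?leq_addr // addKn.
rewrite -(size_basis 2 d) cardE -(size_map (fun m : dmonom d => bmnm (val m))).
apply/eqP; rewrite -uniq_size_uniq ?uniq_basis //.
  rewrite map_inj_uniq ?enum_uniq // => m1 m2 eq_m.
  by apply/val_inj/val_inj.
move=> m; rewrite -basis_cover; apply/eqP/mapP => [deg_m | [m' _ ->]].
  have lt_m : (mdeg m < d.+1)%N by rewrite deg_m.
  have Hm : mdeg (BMultinom lt_m) == d by rewrite /= deg_m.
  by exists (exist _ (BMultinom lt_m) Hm); rewrite ?mem_enum.
by apply/eqP; exact: (valP m').
Qed.

Definition coef_at d (f : {mpoly rat[3]}) (i : 'I_(ncoef d)) : rat :=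
  f@_(bmnm (val (enum_val i))).

(* The first ncoef d variables stand for the coefficients of f, the last ncoef d
   ones for those of g. *)
Definition coef_pair d (f g : {mpoly rat[3]}) (i : 'I_(ncoef d + ncoef d)) : rat :=
  match split i with inl j => coef_at f j | inr j => coef_at g j end.

Definition bihomogeneous k l (P : {mpoly rat[k + l]}) : Prop :=
  exists a b, {in msupp P, forall m : 'X_{1..k + l},
    (\sum_(i < k) m (lshift l i) = a)%N /\ (\sum_(i < l) m (rshift k i) = b)%N}.

(* Zariski-open subsets of the product of two copies of the projective space of
   forms of degree d: complements of common zero loci of families of
   bihomogeneous polynomials. *)
Definition zariski_open d (U : {mpoly rat[3]} -> {mpoly rat[3]} -> Prop) : Prop :=
  exists S : {mpoly rat[ncoef d + ncoef d]} -> Prop,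
    (forall P, S P -> bihomogeneous P) /\
    (forall f g, is_form d f -> is_form d g ->
       (U f g <-> exists2 P, S P & P.@[@coef_pair d f g] != 0)).

(* Main.v *)
(* For the 2-adic part, scale f, g and an element h of I to integral polynomials
   that are nonzero modulo 2; then f and g reduce to x1^d and x2^e x3^e, which
   form a regular sequence.  A relation 2^k h = P f + Q g with k > 0 is a syzygy
   modulo 2, hence a Koszul one, so the exponent k can be lowered to 0, and h
   reduces into the monomial ideal.

   For the standard initial ideals, take (f, g) such that every column submatrix
   of every Macaulay matrix in degrees d, ..., 2d - 1 has the largest rank that it
   can have.  Then, for every term order, the set T_k of leading monomials of
   degree d + k is strongly stable for the induced order x_a > x_b > x_c of the
   variables, and |T_k| = 2 C(k+2, 2).  At most |T_k| - |T_(k-1)| = 2(k+1)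
   elements of T_k are free of x_c, so stability leaves at most
   |T_k| + 2(k+1) + 1 < |T_(k+1)| multiples of T_k in degree d + k + 1.  Hence
   there is a new generator in each of the degrees d + 1, ..., 2d - 1, besides
   the two in degree d: at least d + 1 >= (d + 3) / 2 in total. *)
From Stdlib Require Import Classical ClassicalEpsilon.
Require Import Defs.
From mathcomp Require Import all_boot all_order all_algebra.
From mathcomp.multinomials Require Import mpoly.
From mathcomp Require Import zify.

Set Implicit Arguments.
Unset Strict Implicit.
Unset Printing Implicit Defensive.

Import Order.TTheory GRing.Theory Num.Theory.
Local Open Scope ring_scope.

(** * Ranks and minors *)

(** Characteristic zero supplies [size p] distinct points, more than a nonzero [p] can have
    roots. *)
Lemma nonroot_exists (F : numFieldType) (p : {poly F}) :
  p != 0 -> exists t, p.[t] != 0.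
Proof.
move=> p0; pose s : seq F := [seq i%:R | i <- iota 0 (size p)].
have us : uniq s.
  by rewrite map_inj_uniq ?iota_uniq // => i j /eqP; rewrite eqr_nat => /eqP.
case: (boolP (all (root p) s)) => [rs | /allPn[t _ nr]]; last by exists t.
by have := max_poly_roots p0 rs us; rewrite size_map size_iota ltnn.
Qed.

Lemma horner_det (F : fieldType) n (A : 'M[{poly F}]_n) t :
  (\det A).[t] = \det (map_mx (horner_eval t) A).
Proof. by rewrite det_map_mx. Qed.

(* Otherwise [A + t B] would gain one more independent row for generic [t]. *)
Lemma rank_line_tangent (F : numFieldType) m n (A B : 'M[F]_(m, n)) (v : 'rV_m) :
  (forall t, (\rank (A + t *: B)%R <= \rank A)%N) -> v *m A = 0 ->
  (v *m B <= A)%MS.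
Proof.
move=> maxA vA0; apply: contraT => nvB.
pose f := maxrankfun A.
pose S0 := rowsub f A; pose S1 := rowsub f B.
(* The zero row of [B1] keeps the extra row [v *m B] fixed while the other rows move with [t]. *)
pose B0 := col_mx S0 (v *m B); pose B1 := col_mx S1 (0 : 'rV[F]_n).
have eqS : (S0 :=: A)%MS by apply: eq_maxrowsub.
have freeB0 : row_free B0.
  rewrite -row_leq_rank /B0 -addsmxE (adds_eqmx eqS (eqmx_refl _)).
  have ltA : (A < A + v *m B)%MS by rewrite ltmxE addsmxSl addsmx_sub submx_refl /=.
  by rewrite addn1 ltmxErank in ltA *; case/andP: ltA.
(* With this [N], [(B0 + t *: B1) *m pinvmx B0] is [1 + t *: N], whose determinant is a polynomial
   in [t] with value 1 at 0. *)
pose N := B1 *m pinvmx B0.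
pose q := \det (1%:M + 'X *: map_mx polyC N).
have qE t : q.[t] = \det (1%:M + t *: N).
  rewrite horner_det; congr (\det _); apply/matrixP => i j.
  by rewrite !mxE /horner_eval /= !hornerE; case: eqP; rewrite !hornerE.
have q0 : q != 0.
  by apply/eqP => q0; have := qE 0; rewrite q0 horner0 scale0r addr0 det1 => /eqP;
     rewrite eq_sym oner_eq0.
(* The factor ['X] also forces [t != 0]: since [v *m A = 0], the row [v *m B] is recovered from
   [v *m (A + t *: B)] by dividing by [t]. *)
have [t] : exists t, (q * 'X).[t] != 0.
  by apply: nonroot_exists; rewrite mulf_neq0 ?polyX_eq0.
rewrite hornerM hornerX mulf_eq0 negb_or qE => /andP[dt t0].
have freeBt : row_free (B0 + t *: B1).
  have : row_free ((B0 + t *: B1) *m pinvmx B0).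
    by rewrite mulmxDl mulmxVp // -scalemxAl row_free_unit unitmxE unitfE.
  by rewrite -!row_leq_rank => /leq_trans; apply; exact: mxrankM_maxl.
have sub : ((B0 + t *: B1)%R <= (A + t *: B)%R)%MS.
  have -> : B0 + t *: B1 = col_mx (S0 + t *: S1) (v *m B).
    by rewrite scale_col_mx add_col_mx scaler0 addr0.
  rewrite col_mx_sub.
  apply/andP; split.
    have -> : S0 + t *: S1 = rowsub f (A + t *: B).
      by apply/matrixP => i j; rewrite !mxE.
    exact: rowsub_sub.
  have -> : v *m B = t^-1 *: (v *m (A + t *: B)).
    by rewrite mulmxDr vA0 add0r -scalemxAr scalerA mulVf // scale1r.
  by rewrite scalemx_sub // submxMl.
have := leq_trans (mxrankS sub) (maxA t).
move: freeBt; rewrite -row_leq_rank => h1 h2.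
by have := leq_trans h1 h2; lia.
Qed.

Lemma meval_line n (F : fieldType) (v w : 'I_n -> F) (P : {mpoly F[n]}) :
  exists p : {poly F}, forall t, p.[t] = P.@[fun i => v i + t * (w i - v i)].
Proof.
exists (mmap polyC (fun i => (v i)%:P + 'X * (w i - v i)%:P) P) => t.
rewrite /mmap mevalE horner_sum; apply: eq_bigr => m _.
rewrite hornerM hornerC /mmap1 horner_prod; congr (_ * _).
by apply: eq_bigr => i _; rewrite horner_exp !hornerE.
Qed.

(* Restrict both polynomials to the line through the two points. *)
Lemma nonvanishing_mul n (F : numFieldType) (P Q : {mpoly F[n]}) :
  (exists v, P.@[v] != 0) -> (exists v, Q.@[v] != 0) ->
  exists v, (P * Q).@[v] != 0.
Proof.
move=> [v Pv] [w Qw].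
have [p pE] := meval_line v w P; have [q qE] := meval_line v w Q.
have p0 : p != 0.
  apply: contraNneq Pv => p0; have := pE 0; rewrite p0 horner0 => /esym E.
  by apply/eqP; rewrite -E; apply: meval_eq => i; rewrite mul0r addr0.
have q0 : q != 0.
  apply: contraNneq Qw => q0; have := qE 1; rewrite q0 horner0 => /esym E.
  by apply/eqP; rewrite -E; apply: meval_eq => i; rewrite mul1r addrC subrK.
have [t pqt] := nonroot_exists (mulf_neq0 p0 q0).
by exists (fun i => v i + t * (w i - v i)); rewrite mevalM -pE -qE -hornerM.
Qed.

Lemma max_bounded (T : Type) (x0 : T) (F : T -> nat) b :
  (forall x, (F x <= b)%N) -> exists x, forall y, (F y <= F x)%N.
Proof.
move=> Fb; have [k] := ubnP (b - F x0); elim: k x0 => // k IHk x0 lt_k.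
case: (classic (exists y, (F x0 < F y)%N)) => [[y lt_y] | nex].
  by apply: (IHk y); have := Fb y; lia.
by exists x0 => y; rewrite leqNgt; apply/negP => lt_y; apply: nex; exists y.
Qed.

Lemma minor_of_rank (F : fieldType) m n (A : 'M[F]_(m, n)) :
  exists (f : 'I_(\rank A) -> 'I_m) (g : 'I_(\rank A) -> 'I_n),
    \det (mxsub f g A) != 0.
Proof.
pose f := maxrankfun A; pose B := rowsub f A.
have fB : row_full B^T by rewrite /row_full mxrank_tr; exact: maxrowsub_free.
exists f, (fullrankfun fB).
rewrite -unitfE -unitmxE -row_free_unit.
have -> : mxsub f (fullrankfun fB) A = (rowsub (fullrankfun fB) B^T)^T.
  by apply/matrixP => i j; rewrite !mxE.
by rewrite row_free_unit unitmx_tr -row_free_unit fullrowsub_free.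
Qed.

Lemma rank_minor (F : fieldType) m n r (A : 'M[F]_(m, n))
    (f : 'I_r -> 'I_m) (g : 'I_r -> 'I_n) :
  \det (mxsub f g A) != 0 -> (r <= \rank A)%N.
Proof.
rewrite -unitfE -unitmxE -row_free_unit -row_leq_rank => /leq_trans; apply.
have -> : mxsub f g A = rowsub f 1%:M *m A *m colsub g 1%:M.
  rewrite -mulmxA; apply/matrixP => i j; rewrite !mxE (bigD1 (f i)) //= big1.
    rewrite !mxE eqxx mul1r addr0 (bigD1 (g j)) //= big1 ?addr0.
      by rewrite !mxE eqxx mulr1.
    by move=> l nl; rewrite !mxE (negPf nl) mulr0.
  by move=> l nl; rewrite !mxE eq_sym (negPf nl) mul0r.
by apply: leq_trans (mxrankM_maxl _ _) _; exact: mxrankM_maxr.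
Qed.

(** Take a nonzero minor of maximal size at a point of maximal rank. Wherever that minor survives,
    the rank is again maximal, so maximality of the rank is implied by one polynomial inequation. *)
Lemma max_minor n (F : fieldType) a b (A : 'M[{mpoly F[n]}]_(a, b)) :
  exists r (f : 'I_r -> 'I_a) (g : 'I_r -> 'I_b),
    (exists v, (\det (mxsub f g A)).@[v] != 0) /\
    forall v, (\det (mxsub f g A)).@[v] != 0 -> forall w,
      (\rank (map_mx (meval w) A) <= \rank (map_mx (meval v) A))%N.
Proof.
have [v0 maxv] := @max_bounded _ (fun _ => 0) (fun v => \rank (map_mx (meval v) A)) a
  (fun v => rank_leq_row _).
have [f [g fg]] := minor_of_rank (map_mx (meval v0) A).
have detE v : (\det (mxsub f g A)).@[v] = \det (mxsub f g (map_mx (meval v) A)).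
  rewrite -det_map_mx; congr (\det _).
  by apply/matrixP => i j; rewrite !mxE.
exists _, f, g; split; first by exists v0; rewrite detE.
move=> v; rewrite detE => /rank_minor le_v w.
exact: leq_trans (maxv w) le_v.
Qed.

Lemma seq_max (T : eqType) (le : rel T) (s : seq T) :
  total le -> transitive le -> s != [::] ->
  exists2 x, x \in s & {in s, forall y, le y x}.
Proof.
move=> tot tr; elim: s => // x s IHs _.
have refl y : le y y by have := tot y y; rewrite orbb.
case: (altP (s =P [::])) => [-> | /IHs[y ys ymax]].
  by exists x; rewrite ?inE // => z; rewrite inE => /eqP ->.
case/orP: (tot x y) => lexy.
  by exists y; rewrite ?inE ?ys ?orbT // => z; rewrite inE => /orP[/eqP ->|/ymax].
exists x; rewrite ?inE ?eqxx // => z; rewrite inE => /orP[/eqP -> //|/ymax lezy].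
exact: tr lezy lexy.
Qed.

(** [T] is the set of leading positions of the row space, as in an echelon form. The columns in [T]
    are independent by triangularity, and a nonzero element of the row space cannot vanish on all of
    them. *)
Lemma lead_set_rank (F : fieldType) r n (A : 'M[F]_(r, n)) (le : rel 'I_n)
    (T : {set 'I_n}) :
  total le -> antisymmetric le -> transitive le ->
  (forall x, x \in T <-> exists v : 'rV_r, (v *m A) 0 x != 0 /\
     forall y, y != x -> le x y -> (v *m A) 0 y = 0) ->
  #|T| = \rank A.
Proof.
move=> tot anti tr TP; pose AT := colsub (@enum_val _ (mem T)) A.
have subE (v : 'rV_r) j : (v *m AT) 0 j = (v *m A) 0 (enum_val j).
  by rewrite !mxE; apply: eq_bigr => i _; rewrite !mxE.
have tr' : transitive (fun x y => le y x).
  by move=> y x z /= h1 h2; apply: tr h2 h1.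
have rkAT : \rank AT = #|T|.
  rewrite -mxrank_tr; apply/eqP; rewrite -[_ == _]/(row_free _).
  apply: inj_row_free => c cA.
  apply/eqP; apply: contraT => c0.
  (* [seq_max] is used with the reversed order, so [i] is the least position where [c] is nonzero.
     The vector leading at [i] vanishes above [i], hence pairs with [c] in the single term at
     [i]. *)
  pose s := [seq i <- enum 'I_#|T| | c 0 i != 0].
  have sn : s != [::].
    case/rV0Pn: c0 => i ci; apply/eqP => s0.
    by have : i \in s; [rewrite mem_filter ci mem_enum | rewrite s0].
  have [i] := @seq_max _ (fun x y => le (enum_val y) (enum_val x)) s
     (fun x y => tot _ _) (fun y x z => @tr' _ _ _) sn.
  rewrite mem_filter => /andP[ci _] imax.
  have [v [vi v0]] := (TP (enum_val i)).1 (enum_valP i).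
  have : (v *m (AT *m c^T)) 0 0 = 0.
    by rewrite -[AT]trmxK -trmx_mul cA trmx0 mulmx0 mxE.
  rewrite mulmxA mxE (bigD1 i) //= big1 ?addr0.
    by rewrite subE [c^T _ _]mxE => /eqP; rewrite mulf_eq0 (negPf vi) (negPf ci).
  move=> j ji; rewrite subE [c^T _ _]mxE.
  case: (altP (c 0 j =P 0)) => [->|cj]; first by rewrite mulr0.
  rewrite v0 ?mul0r ?(inj_eq enum_val_inj) //.
  by apply: imax; rewrite mem_filter cj mem_enum.
apply/eqP; rewrite eqn_leq -{1}rkAT; apply/andP; split.
  have -> : AT = A *m colsub (@enum_val _ (mem T)) 1%:M.
    apply/matrixP => i j; rewrite !mxE (bigD1 (enum_val j)) //= big1 ?addr0.
      by rewrite !mxE eqxx mulr1.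
    by move=> l nl; rewrite !mxE (negPf nl) mulr0.
  exact: mxrankM_maxl.
(* A combination of rows that vanishes on [T] is zero, as its largest nonzero position would lie in
   [T]; comparing kernels then compares ranks. *)
rewrite -rkAT; have : (kermx AT <= kermx A)%MS.
  apply/rV_subP => v /sub_kermxP vAT; apply/sub_kermxP.
  apply/eqP; apply: contraT => vA.
  pose s := [seq i <- enum 'I_n | (v *m A) 0 i != 0].
  have sn : s != [::].
    case/rV0Pn: vA => i ci; apply/eqP => s0.
    by have : i \in s; [rewrite mem_filter ci mem_enum | rewrite s0].
  have [x] := seq_max tot tr sn.
  rewrite mem_filter => /andP[vx _] xmax.
  have xT : x \in T.
    apply/TP; exists v; split=> // y yx lexy.
    apply/eqP; apply: contraT => vy.
    have leyx : le y x by apply: xmax; rewrite mem_filter vy mem_enum.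
    by rewrite (anti x y) ?eqxx ?lexy ?leyx in yx.
  have := subE v (enum_rank_in xT x); rewrite vAT mxE enum_rankK_in //.
  by move=> E; rewrite -E eqxx in vx.
move/mxrankS; rewrite !mxrank_ker; have := rank_leq_row A; have := rank_leq_row AT.
lia.
Qed.

(** * Macaulay matrices *)

Definition mon d (i : 'I_(ncoef d)) : 'X_{1..3} := bmnm (val (enum_val i)).

Lemma mdeg_mon d (i : 'I_(ncoef d)) : mdeg (mon i) = d.
Proof. by apply/eqP; exact: (valP (enum_val i)). Qed.

Lemma mon_inj d : injective (@mon d).
Proof. by move=> i j /val_inj/val_inj/enum_val_inj. Qed.

Lemma monP d (m : 'X_{1..3}) : mdeg m = d -> exists i : 'I_(ncoef d), mon i = m.
Proof.
move=> md; have lt_m : (mdeg m < d.+1)%N by rewrite md.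
have Hm : mdeg (BMultinom lt_m) == d by rewrite /= md.
by exists (enum_rank (exist _ (BMultinom lt_m) Hm : dmonom d)); rewrite /mon enum_rankK.
Qed.

(** The values lie in any additive monoid, so that the same matrices can be formed from numbers and
    from indeterminates. *)
Definition coef_of (R : nmodType) d (v : 'I_(ncoef d) -> R) (m : 'X_{1..3}) : R :=
  if [pick i | mon i == m] is Some i then v i else 0.

Lemma coef_of_mon (R : nmodType) d (v : 'I_(ncoef d) -> R) i : coef_of v (mon i) = v i.
Proof.
rewrite /coef_of; case: pickP => [j /eqP/mon_inj -> //|/(_ i)].
by rewrite eqxx.
Qed.

Lemma coef_of_out (R : nmodType) d (v : 'I_(ncoef d) -> R) m :
  mdeg m != d -> coef_of v m = 0.
Proof.
rewrite /coef_of; case: pickP => // i /eqP <-.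
by rewrite mdeg_mon eqxx.
Qed.

Lemma coef_of_homog d (f : {mpoly rat[3]}) m :
  f \is d.-homog -> coef_of (@coef_at d f) m = f@_m.
Proof.
move=> fd; case: (eqVneq (mdeg m) d) => [/monP[i <-]|md].
  by rewrite coef_of_mon.
by rewrite coef_of_out // (dhomog_nemf_coeff fd).
Qed.

(** The left half of the rows holds the multiples of the first form by the monomials of degree [k],
    the right half those of the second. *)
Definition macaulay_entry (R : nmodType) d k
    (v : 'I_(ncoef d + ncoef d) -> R) (i : 'I_(ncoef k + ncoef k)) (m : 'X_{1..3}) : R :=
  match split i with
  | inl a => if (mon a <= m)%MM
             then coef_of (fun j => v (lshift _ j)) (m - mon a)%MM else 0
  | inr a => if (mon a <= m)%MM
             then coef_of (fun j => v (rshift _ j)) (m - mon a)%MM else 0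
  end.

(* Masking the columns outside [C] instead of deleting them keeps all these
   matrices of the same size. *)
Definition macaulay (R : nmodType) d k (C : {set 'I_(ncoef (d + k))})
    (v : 'I_(ncoef d + ncoef d) -> R) : 'M[R]_(ncoef k + ncoef k, ncoef (d + k)) :=
  \matrix_(i, j) if j \in C then macaulay_entry v i (mon j) else 0.

Lemma macaulay_map (R S : nmodType) (phi : {additive R -> S}) d k C v :
  map_mx phi (@macaulay R d k C v) = macaulay C (fun i => phi (v i)).
Proof.
apply/matrixP => i j; rewrite !mxE; case: ifP => _; last exact: raddf0.
rewrite /macaulay_entry; case: split => a; case: ifP => _; rewrite ?raddf0 //;
  by rewrite /coef_of; case: pickP => // _; rewrite raddf0.
Qed.

(** Moving the pair of forms along a line moves the matrix along a line, the situation of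
    [rank_line_tangent]. *)
Lemma macaulay_comb d k C (v w : 'I_(ncoef d + ncoef d) -> rat) t :
  macaulay (k := k) C (fun i => v i + t * w i) = macaulay C v + t *: macaulay C w.
Proof.
apply/matrixP => i j; rewrite !mxE; case: ifP => _; last by rewrite mulr0 addr0.
rewrite /macaulay_entry; case: split => a; case: ifP => _;
  rewrite ?mulr0 ?addr0 //;
  by rewrite /coef_of; case: pickP => // _; rewrite mulr0 addr0.
Qed.

Lemma mcoeff_mulX (R : comNzRingType) n (f : {mpoly R[n]}) u m :
  ('X_[u] * f)@_m = if (u <= m)%MM then f@_(m - u) else 0.
Proof.
case: ifP => [le_um | nle].
  by rewrite mulrC -{1}(submK le_um) addmC mcoeffMX.
apply/eqP; rewrite mcoeff_eq0 mulrC; apply/negP.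
rewrite (perm_mem (msuppMX _ _)) => /mapP[m' _ E].
by rewrite E lem_addr in nle.
Qed.

Lemma homog_comb (R : comNzRingType) k (p : {mpoly R[3]}) (G : 'X_{1..3} -> R) :
  (forall m, mdeg m != k -> G m = 0) ->
  \sum_(m <- msupp p) p@_m * G m = \sum_(a < ncoef k) p@_(mon a) * G (mon a).
Proof.
move=> G0.
transitivity (\sum_(m <- msupp p) \sum_(a < ncoef k | mon a == m) p@_m * G m).
  apply: eq_bigr => m _; case: (eqVneq (mdeg m) k) => [/monP[a <-]|md].
    rewrite (bigD1 a) //= big1 ?addr0 // => b /andP[/eqP/mon_inj ->].
    by rewrite eqxx.
  rewrite G0 // mulr0 big1 // => a _; exact: mulr0.
rewrite (exchange_big_dep xpredT) //=; apply: eq_bigr => a _.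
case: (boolP (mon a \in msupp p)) => ap.
  rewrite (big_rem _ ap) /= eqxx big_seq_cond big1 ?addr0 // => m.
  by rewrite mem_rem_uniq ?msupp_uniq // !inE => /andP[/andP[ne _]]; rewrite eq_sym (negPf ne).
rewrite (memN_msupp_eq0 ap) mul0r big_seq_cond big1 // => m /andP[mp /eqP E].
by rewrite E mp in ap.
Qed.

Lemma mcoeff_mul_homog k d (p f : {mpoly rat[3]}) m : f \is d.-homog -> mdeg m = (d + k)%N ->
  (p * f)@_m = \sum_(a < ncoef k) p@_(mon a) *
     (if (mon a <= m)%MM then f@_(m - mon a) else 0).
Proof.
move=> fd md; rewrite {1}[p]mpolyE mulr_suml raddf_sum /=.
rewrite -(@homog_comb _ k p (fun u => if (u <= m)%MM then f@_(m - u) else 0)).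
  apply: eq_bigr => u _; rewrite -scalerAl mcoeffZ; congr (_ * _).
  exact: mcoeff_mulX.
move=> u uk; case: ifP => // le_um; apply: dhomog_nemf_coeff fd _.
apply: contraNneq uk => E; move/(congr1 (@mdeg 3)): (submK le_um).
by rewrite mdegD E md => /addnI ->.
Qed.

Lemma mcoeff_mul_homog_lt d (p f : {mpoly rat[3]}) m : f \is d.-homog ->
  (mdeg m < d)%N -> (p * f)@_m = 0.
Proof.
move=> fd md; rewrite {1}[p]mpolyE mulr_suml raddf_sum /= big1 // => u _.
rewrite -scalerAl mcoeffZ mcoeff_mulX; case: ifP => le_um; last exact: mulr0.
rewrite (dhomog_nemf_coeff fd) ?mulr0 //; apply/eqP => E.
by have := mdegB m u; rewrite E leqNgt md.
Qed.

Definition coef_row k (p q : {mpoly rat[3]}) : 'rV[rat]_(ncoef k + ncoef k) :=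
  \row_i match split i with inl a => p@_(mon a) | inr a => q@_(mon a) end.

Lemma coef_row_surj k (x : 'rV[rat]_(ncoef k + ncoef k)) :
  exists p q, x = coef_row k p q.
Proof.
pose mk (v : 'I_(ncoef k) -> rat) : {mpoly rat[3]} := \sum_a v a *: 'X_[mon a].
have mkE v a : (mk v)@_(mon a) = v a.
  rewrite raddf_sum (bigD1 a) //= big1 ?addr0 => [|b ba].
    by rewrite mcoeffZ mcoeffX eqxx mulr1.
  by rewrite mcoeffZ mcoeffX (inj_eq (@mon_inj _)) (negPf ba) mulr0.
exists (mk (fun a => x 0 (lshift _ a))), (mk (fun a => x 0 (rshift _ a))).
by apply/rowP => i; rewrite mxE -{1}(splitK i); case: (split i) => a; rewrite mkE.
Qed.

(** This is the dictionary between row combinations and ideal elements: the row space is the degree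
    [d + k] part of the ideal, restricted to the columns in [C]. *)
Lemma coef_row_macaulay d k C (p q f g : {mpoly rat[3]}) j :
  f \is d.-homog -> g \is d.-homog ->
  (coef_row k p q *m macaulay C (@coef_pair d f g)) 0 j =
  if j \in C then (p * f + q * g)@_(mon j) else 0.
Proof.
move=> fd gd; rewrite mxE; under eq_bigr do rewrite !mxE.
case: ifP => jC; last by rewrite big1 // => i _; rewrite mulr0.
rewrite big_split_ord /= mcoeffD !(@mcoeff_mul_homog k d) ?mdeg_mon //.
congr (_ + _); apply: eq_bigr => a _; rewrite /macaulay_entry.
  rewrite -[lshift _ a]/(unsplit (inl a)) unsplitK; congr (_ * _).
  rewrite -(coef_of_homog _ fd); case: ifP => // _; rewrite /coef_of.
  case: pickP => // i _; rewrite /coef_pair.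
  by rewrite -[lshift _ i]/(unsplit (inl i)) unsplitK.
rewrite -[rshift _ a]/(unsplit (inr a)) unsplitK; congr (_ * _).
rewrite -(coef_of_homog _ gd); case: ifP => // _; rewrite /coef_of.
case: pickP => // i _; rewrite /coef_pair.
by rewrite -[rshift _ i]/(unsplit (inr i)) unsplitK.
Qed.

(** * Leading monomials of generic pairs *)

Lemma ideal_pairP (R : comNzRingType) (f g p : R) :
  ideal_gen (fun h => h = f \/ h = g) p <-> exists a b, p = a * f + b * g.
Proof.
split=> [[s [sP ->]] | [a [b ->]]].
  elim: s sP => [|h s IHs] sP.
    by exists 0, 0; rewrite big_nil !mul0r addr0.
  have [|a [b E]] := IHs; first by move=> x xs; apply: sP; rewrite inE xs orbT.
  rewrite big_cons E; have [->|->] := sP h (mem_head _ _).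
    by exists (h.1 + a), b; rewrite mulrDl addrA.
  by exists a, (h.1 + b); rewrite mulrDl addrCA.
exists [:: (a, f); (b, g)]; split; last by rewrite !big_cons big_nil addr0.
by move=> h; rewrite !inE => /orP[] /eqP ->; [left | right].
Qed.

Section Order.
Variables (n : nat) (le : rel 'X_{1..n}).
Hypothesis ord : monomial_order le.

Lemma monomial_order_refl m : le m m.
Proof. by case: ord => tot _ _ _ _; have := tot m m; rewrite orbb. Qed.

Lemma monomial_order_add2r m m1 m2 : le (m1 + m)%MM (m2 + m)%MM = le m1 m2.
Proof.
case: ord => tot anti _ _ addle; apply/idP/idP => [le_m|]; last exact: addle.
case/orP: (tot m1 m2) => // le21; have E : (m1 + m)%MM = (m2 + m)%MM.
  by apply: anti; rewrite le_m addle.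
by move/addIm: E => ->; exact: monomial_order_refl.
Qed.

Lemma lead_monomial_mulX (F : fieldType) (f : {mpoly F[n]}) m u :
  lead_monomial le f m -> lead_monomial le ('X_[u] * f) (m + u)%MM.
Proof.
rewrite mulrC => -[mf maxm]; split.
  by rewrite (perm_mem (msuppMX _ _)); apply/mapP; exists m => //; exact: addmC.
move=> m'; rewrite (perm_mem (msuppMX _ _)) => /mapP[m1 m1f ->].
by rewrite [(u + _)%MM]addmC monomial_order_add2r maxm.
Qed.

End Order.

Section Stability.
Variables (le : rel 'X_{1..3}) (d : nat) (f g : {mpoly rat[3]}).
Hypothesis ord : monomial_order le.
Hypotheses (fd : f \is d.-homog) (gd : g \is d.-homog).

Definition pair_lead (m : 'X_{1..3}) : Prop :=
  exists h, ideal_gen (fun h => h = f \/ h = g) h /\ lead_monomial le h m.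

(* [p] and [q] need not be homogeneous: only the part of [p * f + q * g] in the
   degree of [m] matters, and it is read off a Macaulay matrix. *)
Definition graded_lead (m : 'X_{1..3}) : Prop :=
  exists p q, (p * f + q * g)@_m != 0 /\
    forall m', mdeg m' = mdeg m -> m' != m -> le m m' ->
      (p * f + q * g)@_m' = 0.

Lemma pair_lead_mdeg m : pair_lead m -> (d <= mdeg m)%N.
Proof.
case=> h [/ideal_pairP[a [b ->]] [+ _]].
rewrite mcoeff_msupp leqNgt mcoeffD => nz; apply: contraNN nz => lt_d.
by rewrite !(@mcoeff_mul_homog_lt d) // addr0.
Qed.

Lemma pair_leadD m u : pair_lead m -> pair_lead (m + u)%MM.
Proof.
case=> h [/ideal_pairP[a [b hE]] hm]; exists ('X_[u] * h); split.
  by apply/ideal_pairP; exists ('X_[u] * a), ('X_[u] * b); rewrite hE mulrDr !mulrA.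
exact: lead_monomial_mulX.
Qed.

Lemma mcoeff_pihomog k (p : {mpoly rat[3]}) m :
  (pihomog mdeg k p)@_m = if mdeg m == k then p@_m else 0.
Proof.
rewrite pihomogE raddf_sum /=; case: ifP => mk.
  rewrite [in RHS](mpolyE p) [RHS]raddf_sum /= [RHS](bigID (fun i => mdeg i == k)) /=.
  rewrite [X in _ = _ + X]big1 ?addr0 // => i ik.
  rewrite mcoeffZ mcoeffX; case: eqP => [E|]; last by rewrite mulr0.
  by rewrite E mk in ik.
rewrite big1 // => i ik; rewrite mcoeffZ mcoeffX; case: eqP => [E|]; last by rewrite mulr0.
by rewrite -E ik in mk.
Qed.

(** The ideal is graded: replacing [p] and [q] by their components of degree [mdeg m - d] isolates
    the part of [p * f + q * g] in the degree of [m]. *)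
Lemma pair_leadP m : pair_lead m <-> (d <= mdeg m)%N /\ graded_lead m.
Proof.
split=> [lm | [led [p [q [nz z]]]]].
  split; first exact: pair_lead_mdeg.
  case: lm => h [/ideal_pairP[p [q ->]] [mh maxm]].
  exists p, q; split; first by rewrite -mcoeff_msupp.
  move=> m' _ ne lem'; apply/eqP; rewrite mcoeff_eq0; apply: contraNN ne => m'h.
  by apply/eqP; case: ord => _ anti _ _ _; apply: anti; rewrite lem' maxm.
set k := (mdeg m - d)%N; have mk : mdeg m = (d + k)%N by rewrite subnKC.
pose p' := pihomog mdeg k p; pose q' := pihomog mdeg k q.
have hE m' : (p' * f + q' * g)@_m' =
    if mdeg m' == mdeg m then (p * f + q * g)@_m' else 0.
  case: eqP => [E|/eqP ne].
    rewrite !mcoeffD !(@mcoeff_mul_homog k d) ?E //.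
    by congr (_ + _); apply: eq_bigr => a _; rewrite mcoeff_pihomog mdeg_mon eqxx.
  apply: (@dhomog_nemf_coeff _ _ mdeg (d + k)%N); rewrite -?mk //.
  rewrite mk addnC; have D1 := dhomogM (pihomogP _ k p) fd; have D2 := dhomogM (pihomogP _ k q) gd; exact: (rpredD D1 D2).
exists (p' * f + q' * g); split; first by apply/ideal_pairP; exists p', q'.
split; first by rewrite mcoeff_msupp hE eqxx.
move=> m'; rewrite mcoeff_msupp hE; case: (mdeg m' =P mdeg m) => [E nz'|_]; last by rewrite eqxx.
case: (eqVneq m' m) => [->|ne]; first exact: monomial_order_refl.
case: ord => tot _ _ _ _; case/orP: (tot m' m) => // lem'.
by rewrite z ?eqxx in nz'.
Qed.

(* Strong stability, without a group action: differentiating [p * f + q * g = h]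
   along [D = x_i d/dx_j] shows that [D h] agrees, modulo the ideal, with the
   first-order change of [h] when [(f, g)] moves in the direction [(D f, D g)];
   maximality of the ranks makes that change vanish modulo the ideal on the
   monomials above the target. *)
Lemma pair_lead_stable k m i j :
  (forall C w, (\rank (@macaulay rat d k C w) <=
                \rank (macaulay C (@coef_pair d f g)))%N) ->
  mdeg m = (d + k)%N -> pair_lead m -> (0 < m j)%N -> le U_(j)%MM U_(i)%MM ->
  pair_lead (m - U_(j) + U_(i))%MM.
Proof.
move=> maxr mk /pair_leadP[_ [p [q [nz z]]]] mj leji.
have lejm : (U_(j) <= m)%MM by rewrite lep1mP -lt0n.
case: (eqVneq i j) => [->|neij].
  rewrite submK //; apply/pair_leadP; rewrite mk leq_addr; split=> //.
  by exists p, q.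
have [tot anti tr _ addle] := ord.
set m' := (m - U_(j) + U_(i))%MM.
have m'E : (m' + U_(j))%MM = (m + U_(i))%MM by rewrite /m' -addmA [(U_(i) + _)%MM]addmC addmA submK.
have mdm' : mdeg m' = (d + k)%N.
  by have := congr1 (@mdeg 3) m'E; rewrite !mdegD !mdeg1 mk => /addIn.
have lemm' : le m m'.
  by rewrite -(monomial_order_add2r ord U_(j)) m'E ![(m + _)%MM]addmC monomial_order_add2r.
have nemm' : m' != m.
  apply: contraNneq neij => E; move: m'E; rewrite E => /addmI U.
  by have := mnm1E j i; rewrite U mnm1E eqxx; case: eqP => // ->.
(* These are the columns at or above the target [m']. They lie strictly above [m], so
   [p * f + q * g] vanishes on all of them. *)
pose C := [set a : 'I_(ncoef (d + k)) | le m' (mon a)].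
pose D (h : {mpoly rat[3]}) := 'X_i * h^`M(j).
have DE h u : (D h)@_u = if (U_(i) <= u)%MM
    then h@_(u - U_(i) + U_(j)) *+ ((u - U_(i))%MM j).+1 else 0.
  by rewrite /D mcoeff_mulX; case: ifP => // _; rewrite mcoeff_deriv.
have DM a b : D (a * b) = D a * b + a * D b.
  by rewrite /D mderivM mulrDr !mulrA [a * 'X_i]mulrC.
have Dd h : h \is d.-homog -> D h \is d.-homog.
  move=> hd; apply/dhomogP => u; rewrite mcoeff_msupp DE;
  case: ifP => leu; last by rewrite eqxx.
  case: (eqVneq (mdeg (u - U_(i) + U_(j))%MM) d) => [<- _|/(dhomog_nemf_coeff hd) ->].
    have E := congr1 (@mdeg 3) (submK leu); rewrite mdegD mdeg1 in E.
    by rewrite mdegD mdeg1 E.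
  by rewrite mul0rn eqxx.
pose x := coef_row k p q.
have x0 : x *m macaulay C (@coef_pair d f g) = 0.
  apply/rowP => a; rewrite coef_row_macaulay // [RHS]mxE; case: ifP => //.
  rewrite inE => lea; apply: z; rewrite ?mdeg_mon ?mk //.
    apply: contraNneq nemm' => E; rewrite E in lea.
    by apply/eqP/anti; rewrite lea.
  exact: tr lemm' lea.
have /submxP[y] : (x *m macaulay C (@coef_pair d (D f) (D g)) <=
    macaulay C (@coef_pair d f g))%MS.
  by apply: rank_line_tangent => // t; rewrite -macaulay_comb.
have [p1 [q1 ->]] := coef_row_surj y => E.
apply/pair_leadP; rewrite mdm' leq_addr; split=> //.
(* On [C], [p1 * f + q1 * g] equals [p * D f + q * D g], so the new combination agrees there with
   [D (p * f + q * g)] by the Leibniz rule. Its coefficient at [m'] is the one of [p * f + q * g] at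
   [m] times a positive integer. *)
exists (p1 + D p), (q1 + D q).
have hE u : mdeg u = (d + k)%N -> le m' u ->
    ((p1 + D p) * f + (q1 + D q) * g)@_u = (D (p * f + q * g))@_u.
  move=> /monP[a <-] lea; move/rowP/(_ a): E.
  rewrite !coef_row_macaulay ?Dd // inE lea => E.
  have -> : D (p * f + q * g) = (D p * f + D q * g) + (p * D f + q * D g).
    by rewrite /D mderivD mulrDr -!/(D _) !DM addrACA.
  by rewrite [RHS]mcoeffD E -mcoeffD !mulrDl addrACA addrC.
have lerefl := monomial_order_refl ord.
split.
  rewrite hE // DE /m' lem_addl addmK submK // mulrn_eq0 negb_or nz andbT.
  by [].
move=> u; rewrite mdm' => du ne lem'u; rewrite hE // DE; case: ifP => // leiu.
set v := (u - U_(i) + U_(j))%MM.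
have vE : (v + U_(i))%MM = (u + U_(j))%MM by rewrite /v -addmA [(U_(j) + _)%MM]addmC addmA submK.
rewrite z ?mul0rn //.
- by have := congr1 (@mdeg 3) vE; rewrite !mdegD !mdeg1 du mk => /addIn.
- apply: contraNneq ne => vm; move: vE; rewrite vm -m'E => /addIm ->.
  by [].
by rewrite -(monomial_order_add2r ord U_(i)) vE -m'E monomial_order_add2r.
Qed.

End Stability.

(** Multipliers of degree [k < d] are too small for a Koszul syzygy, so this one example shows that
    the largest possible rank is the number of rows. *)
Lemma macaulay_pure_powers_free d k : (k < d)%N ->
  row_free (@macaulay rat d k setT (@coef_pair d ('X_i1 ^+ d) ('X_i2 ^+ d))).
Proof.
move=> kd; apply: inj_row_free => x; have [p [q ->]] := coef_row_surj x => x0.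
have Xd i : ('X_i ^+ d : {mpoly rat[3]}) \is d.-homog.
  by rewrite mpolyXn dhomogX /= mdegMn mdeg1 mul1n.
have coefE m : mdeg m = (d + k)%N -> (p * 'X_i1 ^+ d + q * 'X_i2 ^+ d)@_m = 0.
  move=> /monP[j <-]; have /rowP/(_ j) := x0.
  by rewrite (coef_row_macaulay _ _ _ _ (Xd i1) (Xd i2)) in_setT mxE.
have big (u : 'X_{1..3}) i : mdeg u = k -> (d <= u i)%N = false.
  move=> uk; apply/negbTE; rewrite -ltnNge; apply: leq_ltn_trans kd.
  by rewrite -uk mdegE (bigD1 i) //= leq_addr.
apply/rowP => i; rewrite !mxE; case: (split i) => a.
  (* At this monomial the other product could contribute only if [x_2^d] divided [mon a], which has
     degree [k < d]. *)
  have := coefE (mon a + U_(i1) *+ d)%MM.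
  rewrite mdegD mdeg_mon mdegMn mdeg1 mul1n addnC => /(_ erefl).
  rewrite !mpolyXn mcoeffD ![_ * 'X_[_]]mulrC !mcoeff_mulX lem_addl addmK.
  case: ifP => [/mnm_lepP/(_ i2)|_]; last by rewrite addr0.
  by rewrite mnmDE !mulmnE !mnm1E /= mul1n mul0n addn0 big ?mdeg_mon.
have := coefE (mon a + U_(i2) *+ d)%MM.
rewrite mdegD mdeg_mon mdegMn mdeg1 mul1n addnC => /(_ erefl).
rewrite !mpolyXn mcoeffD ![_ * 'X_[_]]mulrC !mcoeff_mulX lem_addl addmK.
case: ifP => [/mnm_lepP/(_ i1)|_]; last by rewrite add0r.
by rewrite mnmDE !mulmnE !mnm1E /= mul1n mul0n addn0 big ?mdeg_mon.
Qed.

(** Maximality and the pure powers give full row rank, and [lead_set_rank] turns the rank into the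
    number of leading monomials. *)
Lemma pair_lead_count (le : rel 'X_{1..3}) d f g k (T : {set 'I_(ncoef (d + k))}) :
  monomial_order le -> f \is d.-homog -> g \is d.-homog -> (k < d)%N ->
  (forall w, (\rank (@macaulay rat d k setT w) <=
              \rank (@macaulay _ d k setT (@coef_pair d f g)))%N) ->
  (forall a, a \in T <-> pair_lead le f g (mon a)) ->
  #|T| = (ncoef k + ncoef k)%N.
Proof.
move=> ord fd gd kd maxr TP.
have := macaulay_pure_powers_free kd; rewrite -row_leq_rank => rk.
have {rk} := leq_trans rk (maxr _) => rk.
have [tot anti tr _ _] := ord.
rewrite (@lead_set_rank _ _ _ (@macaulay _ d k setT (@coef_pair d f g))
    (fun a b => le (mon a) (mon b))).
- by apply/eqP; rewrite eqn_leq rk rank_leq_row.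
- by move=> a b; exact: tot.
- by move=> a b /anti/mon_inj.
- by move=> a b c; exact: tr.
move=> a; apply: (iff_trans (TP a)); apply: (iff_trans (pair_leadP ord fd gd _)).
rewrite mdeg_mon leq_addr; split.
  case=> _ [p [q [nz z]]]; exists (coef_row k p q).
  rewrite coef_row_macaulay // in_setT nz; split=> // b ne leab.
  rewrite coef_row_macaulay // in_setT z // ?mdeg_mon //.
  by rewrite (inj_eq (@mon_inj _)).
case=> x; have [p [q ->]] := coef_row_surj x.
rewrite coef_row_macaulay // in_setT => -[nz z]; split=> //.
exists p, q; split=> // m'; rewrite mdeg_mon => /monP[b <-].
rewrite (inj_eq (@mon_inj _)) => ne leab.
by have := z b ne leab; rewrite coef_row_macaulay // in_setT.
Qed.

(** * Monomial ideals *)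

Section MonomialIdeals.
Variables (n : nat) (F : fieldType).

Lemma ideal_gen0 (R : comNzRingType) (G : R -> Prop) : ideal_gen G 0.
Proof. by exists [::]; rewrite big_nil; split. Qed.

Lemma ideal_genD (R : comNzRingType) (G : R -> Prop) p q :
  ideal_gen G p -> ideal_gen G q -> ideal_gen G (p + q).
Proof.
move=> [s [sG ->]] [t [tG ->]]; exists (s ++ t); split; last by rewrite big_cat.
by move=> h; rewrite mem_cat => /orP[/sG|/tG].
Qed.

Lemma ideal_gen_mull (R : comNzRingType) (G : R -> Prop) a q :
  G q -> ideal_gen G (a * q).
Proof.
move=> Gq; exists [:: (a, q)]; rewrite big_seq1; split=> // h.
by rewrite inE => /eqP ->.
Qed.

(** Common core for monomial ideals and initial ideals; the scalars are there because generators of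
    an initial ideal carry leading coefficients. *)
Lemma monomial_gensP (G : {mpoly F[n]} -> Prop) (S : 'X_{1..n} -> Prop) p :
  (forall q, G q -> exists m c, S m /\ q = c *: 'X_[m]) ->
  (forall m, S m -> exists2 c, c != 0 & G (c *: 'X_[m])) ->
  ideal_gen G p <-> {in msupp p, forall m, exists m', S m' /\ (m' <= m)%MM}.
Proof.
move=> GS SG; split=> [[s [sG ->]] | supp].
  elim: s sG => [|h s IHs] sG m; first by rewrite big_nil msupp0.
  rewrite big_cons => /msuppD_le; rewrite mem_cat => /orP[|]; last first.
    by apply: IHs => x xs; apply: sG; rewrite inE xs orbT.
  have [m' [c [Sm' ->]]] := GS _ (sG _ (mem_head _ _)).
  rewrite mcoeff_msupp -scalerAr mcoeffZ [h.1 * _]mulrC mcoeff_mulX.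
  by case: ifP => [le_m _|_]; [exists m' | rewrite mulr0 eqxx].
rewrite [p]mpolyE big_seq; apply: big_ind => [||m /supp[m' [Sm' le_m]]].
- exact: ideal_gen0.
- by move=> x y; exact: ideal_genD.
have [c c0 Gc] := SG _ Sm'.
have -> : p@_m *: 'X_[m] = ((p@_m / c) *: 'X_[m - m']) * (c *: 'X_[m']) :> {mpoly F[n]}.
  by rewrite -scalerAl -scalerAr scalerA -mpolyXD submK // divfK.
exact: ideal_gen_mull.
Qed.

Lemma monomial_idealP (s : seq 'X_{1..n}) (p : {mpoly F[n]}) :
  monomial_ideal F s p <->
  {in msupp p, forall m, exists m', m' \in s /\ (m' <= m)%MM}.
Proof.
apply: monomial_gensP => [q [m ms ->] | m ms]; first by exists m, 1; rewrite scale1r.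
by exists 1; rewrite ?oner_eq0 // scale1r; exists m.
Qed.

Lemma initial_idealP (le : rel 'X_{1..n}) (I : {mpoly F[n]} -> Prop) (p : {mpoly F[n]}) :
  initial_ideal le I p <->
  {in msupp p, forall m, exists m', (exists h, I h /\ lead_monomial le h m') /\ (m' <= m)%MM}.
Proof.
apply: monomial_gensP => [q [f [m [If lf ->]]] | m [f [If lf]]].
  by exists m, f@_m; split=> //; exists f.
exists f@_m; last by exists f, m.
by case: lf; rewrite mcoeff_msupp.
Qed.

(* Induction on the number [k] of exponents that are compared. *)
Lemma dickson_prefix k (P : 'X_{1..n} -> Prop) :
  exists s : seq 'X_{1..n}, {in s, forall m, P m} /\
    forall m, P m -> exists2 m', m' \in s & forall i : 'I_n, (i < k)%N -> (m' i <= m i)%N.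
Proof.
elim: k P => [|k IHk] P.
  case: (classic (exists m, P m)) => [[m Pm]|nP].
    exists [:: m]; split=> [x|x _]; first by rewrite inE => /eqP ->.
    by exists m; rewrite ?inE.
  by exists [::]; split=> // m Pm; case: nP; exists m.
case: (ltnP k n) => [lt_kn|le_nk]; last first.
  have [s [sP sdom]] := IHk P; exists s; split=> // m /sdom[m' m's le_m'].
  by exists m' => // i _; apply: le_m'; exact: leq_trans (ltn_ord i) le_nk.
pose o := Ordinal lt_kn.
have slices N : exists s : seq 'X_{1..n}, {in s, forall m, P m} /\
    forall m, P m -> (m o < N)%N ->
      exists2 m', m' \in s & forall i : 'I_n, (i < k.+1)%N -> (m' i <= m i)%N.
  elim: N => [|N [s [sP sdom]]]; first by exists [::].
  have [t [tP tdom]] := IHk (fun m => P m /\ m o = N).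
  exists (s ++ t); split.
    by move=> m; rewrite mem_cat => /orP[/sP|/tP[]].
  move=> m Pm; rewrite ltnS leq_eqVlt => /orP[/eqP mN|/(sdom m Pm)[m' m's le_m']]; last first.
    by exists m'; rewrite ?mem_cat ?m's.
  have [m' m't le_m'] := tdom m (conj Pm mN).
  exists m'; rewrite ?mem_cat ?m't ?orbT // => i; rewrite ltnS leq_eqVlt => /orP[/eqP ik|/le_m' //].
  have -> : i = o by exact: val_inj.
  by have [_ ->] := tP _ m't; rewrite mN.
have [s0 [s0P s0dom]] := IHk P.
(* Below the largest exponent at [o] occurring in [s0], finitely many slices suffice; from that
   exponent on, [s0] dominates coordinate [o] as well. *)
have [s1 [s1P s1dom]] := slices (\max_(m <- s0) m o)%N.
exists (s0 ++ s1); split; first by move=> m; rewrite mem_cat => /orP[/s0P|/s1P].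
move=> m Pm; case: (ltnP (m o) (\max_(m <- s0) m o)%N) => [/(s1dom m Pm)[m' m's le_m']|le_max].
  by exists m'; rewrite ?mem_cat ?m's ?orbT.
have [m' m's le_m'] := s0dom m Pm; exists m'; first by rewrite mem_cat m's.
move=> i; rewrite ltnS leq_eqVlt => /orP[/eqP ik|/le_m' //].
have -> : i = o by exact: val_inj.
exact: leq_trans (leq_bigmax_seq m' m's isT) le_max.
Qed.

Lemma dickson (P : 'X_{1..n} -> Prop) :
  exists s : seq 'X_{1..n}, {in s, forall m, P m} /\
    forall m, P m -> exists2 m', m' \in s & (m' <= m)%MM.
Proof.
have [s [sP sdom]] := dickson_prefix n P; exists s; split=> // m /sdom[m' m's le_m'].
by exists m' => //; apply/mnm_lepP => i; exact: le_m'.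
Qed.

Lemma lem_trans (m1 m2 m3 : 'X_{1..n}) : (m1 <= m2)%MM -> (m2 <= m3)%MM -> (m1 <= m3)%MM.
Proof.
move=> /mnm_lepP le1 /mnm_lepP le2; apply/mnm_lepP => i.
exact: leq_trans (le1 i) (le2 i).
Qed.

Lemma minimal_monomials (P : 'X_{1..n} -> Prop) :
  exists s : seq 'X_{1..n}, [/\ uniq s, {in s, forall m, P m},
    forall m, P m -> exists2 m', m' \in s & (m' <= m)%MM
    & {in s &, forall m m', (m' <= m)%MM -> m' = m}].
Proof.
have [s0 [s0P s0dom]] := dickson P.
pose s := [seq m <- undup s0 | all (fun m' => (m' <= m)%MM ==> (m' == m)) s0].
have memE m : (m \in s) = all (fun m' => (m' <= m)%MM ==> (m' == m)) s0 && (m \in s0).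
  by rewrite mem_filter mem_undup.
exists s; split.
- by rewrite filter_uniq // undup_uniq.
- by move=> m; rewrite memE => /andP[_ /s0P].
- move=> m /s0dom[m0 m0s le_m0].
  suff [m' m's le_m'] : exists2 m', m' \in s & (m' <= m0)%MM.
    by exists m' => //; exact: lem_trans le_m' le_m0.
  (* An element of [s0] that is not minimal has a proper divisor in [s0], of smaller degree, so the
     descent stops at a minimal one. *)
  have [N] := ubnP (mdeg m0); elim: N m0 m0s {le_m0} => // N IHN m0 m0s lt_N.
  case: (boolP (all (fun m' => (m' <= m0)%MM ==> (m' == m0)) s0)) => [min|].
    by exists m0; rewrite ?memE ?min // lepm_refl.
  case/allPn => m1 m1s; rewrite negb_imply => /andP[le1 ne1].
  have lt1 : (mdeg m1 < mdeg m0)%N.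
    rewrite -(submK le1) mdegD -[X in (X < _)%N]add0n ltn_add2r lt0n mdeg_eq0.
    by apply: contraNneq ne1 => E; rewrite -(submK le1) E add0m.
  have [m' m's le'] := IHN m1 m1s (leq_trans lt1 lt_N).
  by exists m' => //; exact: lem_trans le' le1.
move=> m m'; rewrite !memE => /andP[/allP min _] /andP[_ m's] le_m'.
by have /implyP/(_ le_m')/eqP := min _ m's.
Qed.

(** Irredundance comes from [s] being an antichain for divisibility: without [m], the monomial
    ['X_[m]] would need another divisor in [s]. *)
Lemma minimal_generators_initial (le : rel 'X_{1..n}) (I : {mpoly F[n]} -> Prop) s :
  let L m := exists h, I h /\ lead_monomial le h m in
  uniq s -> {in s, forall m, L m} ->
  (forall m, L m -> exists2 m', m' \in s & (m' <= m)%MM) ->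
  {in s &, forall m m', (m' <= m)%MM -> m' = m} ->
  minimal_generators (initial_ideal le I) s.
Proof.
move=> L us sL sdom anti; split=> // [p | m ms].
  rewrite initial_idealP monomial_idealP; split=> supp m /supp[m'] [].
    move=> /sdom[m1 m1s le1] le2; exists m1; split=> //; exact: lem_trans le1 le2.
  by move=> m's le1; exists m'; split=> //; exact: sL.
move=> /(_ 'X_[m]); rewrite initial_idealP monomial_idealP msuppX => -[H _].
have [x|m' [m's le']] := H _ m (mem_head _ _).
  by rewrite inE => /eqP ->; exists m; split; [exact: sL | exact: lepm_refl].
move: m's; rewrite mem_rem_uniq // inE => /andP[/eqP ne m's].
by apply: ne; apply: anti.
Qed.

End MonomialIdeals.

(** * Counting generators *)

Lemma ncoefS k : ncoef k.+1 = (ncoef k + k.+2)%N.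
Proof. by rewrite !ncoefE !addn2 binS bin1. Qed.

(** The sorting relation is reversed, so [a] is the largest variable and [c] the smallest. *)
Lemma sorted_variables (le : rel 'X_{1..3}) : monomial_order le ->
  exists a b c : 'I_3, [/\ forall i, i \in [:: a; b; c],
    le U_(b)%MM U_(a)%MM, le U_(c)%MM U_(b)%MM & le U_(c)%MM U_(a)%MM].
Proof.
case=> tot _ tr _ _; pose r (i j : 'I_3) := le U_(j)%MM U_(i)%MM.
pose s := sort r (enum 'I_3).
have ss : sorted r s by apply: sort_sorted => i j; exact: tot.
have ms i : i \in s by rewrite mem_sort mem_enum.
have : size s = 3 by rewrite size_sort size_enum_ord.
case: s ss ms => [|a [|b [|c [|? ?]]]] //= /and3P[ab bc _] ms _.
by exists a, b, c; split=> //; exact: tr bc ab.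
Qed.

Section GeneratorCount.
Variables (d : nat) (L : 'X_{1..3} -> Prop) (a b c : 'I_3).
Hypothesis d_gt0 : (0 < d)%N.
Hypothesis all_abc : forall i, i \in [:: a; b; c].
Hypothesis LD : forall m u, L m -> L (m + u)%MM.
Hypothesis L_mdeg : forall m, L m -> (d <= mdeg m)%N.
Hypothesis L_count : forall k, (k < d)%N -> forall T : {set 'I_(ncoef (d + k))},
  (forall i, i \in T <-> L (mon i)) -> #|T| = (ncoef k + ncoef k)%N.
(** Exchanges are demanded only in degrees [d] to [2d - 1], the range in which the ranks are
    controlled. *)
Definition stable_under (i j : 'I_3) := forall k m, (k < d)%N -> mdeg m = (d + k)%N ->
  L m -> (0 < m j)%N -> L (m - U_(j) + U_(i))%MM.
Hypotheses (Lcb : stable_under b c) (Lca : stable_under a c) (Lba : stable_under a b).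

(** A classical boolean version of [L], by which lists of monomials can be filtered. *)
Let l m : bool := if excluded_middle_informative (L m) then true else false.

Let lP m : reflect (L m) (l m).
Proof. by rewrite /l; case: excluded_middle_informative => H; constructor. Qed.

Let T D : seq 'X_{1..3} := [seq m <- [seq mon i | i <- enum 'I_(ncoef D)] | l m].

Let mem_T D m : (m \in T D) = (mdeg m == D) && l m.
Proof.
rewrite mem_filter andbC; congr (_ && _); apply/mapP/eqP => [[i _ ->]|/monP[i <-]].
  exact: mdeg_mon.
by exists i; rewrite ?mem_enum.
Qed.

Let uniq_T D : uniq (T D).
Proof. by rewrite filter_uniq // map_inj_uniq ?enum_uniq //; exact: mon_inj. Qed.

Let size_T k : (k < d)%N -> size (T (d + k)) = (ncoef k + ncoef k)%N.
Proof.
move=> kd; rewrite -(L_count kd (T := [set i | l (mon i)])).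
  rewrite size_filter count_map cardE [in RHS]/enum_mem size_filter -enumT.
  by apply: eq_count => i; rewrite /= inE.
by move=> i; rewrite inE; split=> /lP.
Qed.

Let T_free D := [seq m : 'X_{1..3} <- T D | m c == 0%N].

(* Multiples of [x_c] in degree [D + 1] already fill a copy of degree [D]. *)
Let size_T_free D : (size (T D) + size (T_free D.+1) <= size (T D.+1))%N.
Proof.
rewrite -(size_map (fun m => m + U_(c))%MM (T D)) -size_cat.
apply: uniq_leq_size.
  rewrite cat_uniq (map_inj_uniq (@addIm _ _)) uniq_T filter_uniq ?uniq_T // andbT /=.
  apply/hasPn => m; rewrite mem_filter => /andP[/eqP mc _].
  by apply/mapP => -[m' _ E]; move: mc; rewrite E mnmDE mnm1E eqxx addn1.
move=> m; rewrite mem_cat => /orP[/mapP[m' + ->]|].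
  rewrite !mem_T mdegD mdeg1 addn1 eqSS => /andP[-> /lP Lm].
  by apply/lP; exact: LD.
by rewrite mem_filter => /andP[].
Qed.

(* By stability the multiples of [T (d + k)] are the multiples by [x_c], those by
   [x_b] of the monomials free of [x_c], and a power of [x_a]: too few. *)
Let new_monomial k : (k.+1 < d)%N ->
  exists2 m, m \in T (d + k).+1 & forall m' i, m' \in T (d + k) -> m <> (m' + U_(i))%MM.
Proof.
move=> kd; apply: NNPP => nex.
have kd' : (k < d)%N by exact: ltn_trans kd.
pose old := [seq (m + U_(c))%MM | m <- T (d + k)] ++
  [seq (m + U_(b))%MM | m <- T_free (d + k)] ++ [:: (U_(a) *+ (d + k).+1)%MM].
have sub : {subset T (d + k).+1 <= old}.
  move=> m mT; have : exists m' i, m' \in T (d + k) /\ m = (m' + U_(i))%MM.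
    apply: NNPP => nm; apply: nex; exists m => // m' i m'T E.
    by apply: nm; exists m', i.
  case=> m' [i [m'T E]].
  have mdm' : mdeg m' = (d + k)%N by move: m'T; rewrite mem_T => /andP[/eqP].
  have Lm' : L m' by move: m'T; rewrite mem_T => /andP[_ /lP].
  have viac (x : 'X_{1..3}) : mdeg x = (d + k)%N -> L x -> (x + U_(c))%MM \in old.
    move=> dx Lx; rewrite mem_cat; apply/orP; left; apply/mapP; exists x => //.
    by rewrite mem_T dx eqxx; apply/lP.
  have viab (x : 'X_{1..3}) : mdeg x = (d + k)%N -> L x -> x c = 0%N ->
      (x + U_(b))%MM \in old.
    move=> dx Lx xc; rewrite mem_cat mem_cat; apply/orP; right; apply/orP; left.
    apply/mapP; exists x => //.
    by rewrite mem_filter xc eqxx mem_T dx eqxx; apply/lP.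
  have swap j (x : 'X_{1..3}) : (0 < x j)%N -> (x + U_(i))%MM = (x - U_(j) + U_(i) + U_(j))%MM.
    move=> xj; rewrite -[in RHS]addmA [(U_(i) + _)%MM]addmC addmA submK //.
    by rewrite lep1mP -lt0n.
  have swapd j (x : 'X_{1..3}) : (0 < x j)%N -> mdeg (x - U_(j) + U_(i))%MM = mdeg x.
    move=> xj; have := congr1 (@mdeg 3) (swap j x xj).
    by rewrite !mdegD !mdeg1 => /addIn.
  have stay j (x : 'X_{1..3}) : L x -> (0 < x j)%N -> i = j -> L (x - U_(j) + U_(i))%MM.
    by move=> Lx xj ->; rewrite submK // lep1mP -lt0n.
  (* If [x_c] divides [m'], trade it for [x_i] inside [m'] and multiply by [x_c] instead; failing
     that, do the same with [x_b]. What remains is a power of [x_a] times [x_a]. *)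
  have [m'c0|m'c] := posnP (m' c); last first.
    rewrite E (swap c) //; apply: viac; first by rewrite swapd.
    move: (all_abc i); rewrite !inE => /or3P[] /eqP ei; last exact: stay.
      by rewrite ei; apply: Lca kd' mdm' _ _.
    by rewrite ei; apply: Lcb kd' mdm' _ _.
  case: (eqVneq i c) => [->|nic] in E *; first by rewrite E; apply: viac.
  have [m'b0|m'b] := posnP (m' b); last first.
    rewrite E (swap b) //; apply: viab; first by rewrite swapd.
      move: (all_abc i); rewrite !inE => /or3P[] /eqP ei; last by rewrite ei eqxx in nic.
        by rewrite ei; apply: Lba kd' mdm' _ _.
      exact: stay.
    by rewrite mnmDE mnmBE m'c0 sub0n mnm1E (negPf nic).
  case: (eqVneq i b) => [->|nib] in E *; first by rewrite E; apply: viab.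
  have ia : i = a.
    by move: (all_abc i); rewrite !inE (negPf nic) (negPf nib) !orbF => /eqP.
  rewrite mem_cat mem_cat; apply/orP; right; apply/orP; right.
  rewrite inE E ia -mdm'; apply/eqP/mnmP => j; rewrite mnmDE mulmnE mnm1E.
  have m'a : mdeg m' = m' a.
    rewrite mdegE (bigD1 a) //= big1 ?addn0 // => x xa.
    by move: (all_abc x); rewrite !inE (negPf xa) /= => /orP[] /eqP ->.
  case: eqP => [<-|/eqP aj]; first by rewrite mul1n m'a addn1.
  rewrite mul0n addn0.
  by move: (all_abc j); rewrite !inE eq_sym (negPf aj) /= => /orP[] /eqP ->.
have := uniq_leq_size (uniq_T _) sub; rewrite !size_cat !size_map /= -addnS !size_T //.
(* For [k = 0] the bound is [|T d| = 2]; otherwise it is the difference of two consecutive counts.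
   Then [old] has at most [2k + 3] elements more than [T (d + k)], while [T (d + k).+1] has [2k + 4]
   more. *)
have free : (size (T_free (d + k)) <= k.*2.+2)%N.
  case: (k) kd' => [|k'] kd'.
    rewrite (leq_trans (size_subseq (filter_subseq _ _))) //.
    by rewrite size_T // ncoefE.
  have := size_T_free (d + k'); rewrite -addnS !size_T ?(ltnW kd') // ncoefS.
  by rewrite -addnn; lia.
by rewrite ncoefS -addnn in free *; lia.
Qed.

(** By induction on [k], [s] contains [k + 2] elements of degree at most [d + k]: two in degree [d],
    then one new monomial per degree. The last case [k = d - 1] gives [d + 1]. *)
Lemma generator_count (s : seq 'X_{1..3}) : {in s, forall m, L m} ->
  (forall m, L m -> exists2 m', m' \in s & (m' <= m)%MM) ->
  (d < size s)%N.
Proof.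
move=> sL sdom.
have chain k : (k < d)%N -> exists w : seq 'X_{1..3},
    [/\ uniq w, {subset w <= s}, {in w, forall m, (mdeg m <= d + k)%N} & size w = k.+2].
  elim: k => [|k IHk] kd.
    (* A monomial of [T d] lies in [s]: its divisor in [s] has degree at least [d], so the two
       coincide. *)
    exists (T d); rewrite uniq_T -[X in T X]addn0 size_T // ncoefE; split=> //.
      move=> m; rewrite addn0 mem_T => /andP[/eqP dm /lP Lm].
      have [m' m's le_m'] := sdom _ Lm.
      suff -> : m = m' by [].
      have dm' := L_mdeg (sL _ m's).
      have := congr1 (@mdeg 3) (submK le_m').
      rewrite mdegD dm => E.
      have /eqP : mdeg (m - m')%MM = 0%N by move: E dm'; lia.
      by rewrite mdeg_eq0 => /eqP z; rewrite -(submK le_m') z add0m.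
    by move=> m; rewrite addn0 mem_T => /andP[/eqP ->].
  have [w [uw ws wd sw]] := IHk (ltnW kd).
  have [m mT mnew] := new_monomial kd.
  move: mT; rewrite mem_T => /andP[/eqP dm /lP Lm].
  exists (m :: w); split=> /=.
  - rewrite uw andbT; apply/negP => /wd; rewrite dm ltnn //.
  (* The new [m] lies in [s]: were its divisor in [s] a proper one, [m] would be a variable times an
     element of [T (d + k)]. *)
  - move=> x; rewrite inE => /orP[/eqP ->|/ws //].
    have [m' m's le_m'] := sdom _ Lm.
    suff -> : m = m' by [].
    have mE := submK le_m'.
    case: (eqVneq (m - m')%MM 0%MM) => [z|nz]; first by rewrite -mE z add0m.
    have [i ui] : exists i, (0 < (m - m')%MM i)%N.
      apply: NNPP => ni; case/negP: nz; apply/eqP/mnmP => i; rewrite mnm0E.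
      by apply/eqP; rewrite -leqn0 leqNgt; apply/negP => h; apply: ni; exists i.
    have leu : (U_(i) <= m - m')%MM by rewrite lep1mP -lt0n.
    have E : m = (m' + (m - m' - U_(i)) + U_(i))%MM.
      by rewrite -addmA submK // addmC.
    case: (mnew (m' + (m - m' - U_(i)))%MM i _ E).
    rewrite mem_T; apply/andP; split; last by apply/lP; apply: LD; exact: sL.
    by have := congr1 (@mdeg 3) E; rewrite mdegD mdeg1 dm addn1 => -[->].
  - by move=> x; rewrite inE => /orP[/eqP ->|/wd]; rewrite ?dm addnS // => /leqW.
  - by rewrite sw.
have [|w [uw ws _ sw]] := chain d.-1; first by rewrite prednK.
by have := uniq_leq_size uw ws; rewrite sw prednK.
Qed.

End GeneratorCount.

(** * Genericity *)

(** Naming the bidegree allows tracking it through sums and products; the zero polynomial has every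
    bidegree. *)
Definition bidegree k l (a b : nat) (P : {mpoly rat[k + l]}) : Prop :=
  {in msupp P, forall m : 'X_{1..k + l},
    (\sum_(i < k) m (lshift l i) = a)%N /\ (\sum_(i < l) m (rshift k i) = b)%N}.

Lemma bidegreeM k l a b a' b' (P Q : {mpoly rat[k + l]}) :
  bidegree a b P -> bidegree a' b' Q -> bidegree (a + a') (b + b') (P * Q).
Proof.
move=> hP hQ m /msuppM_le/allpairsP[[m1 m2] [/= /hP[<- <-] /hQ[<- <-] ->]].
by split; rewrite -big_split /=; apply: eq_bigr => i _; rewrite mnmDE.
Qed.

Lemma bidegree0 k l a b : bidegree a b (0 : {mpoly rat[k + l]}).
Proof. by move=> m; rewrite msupp0. Qed.

Lemma bidegreeC k l c : bidegree 0 0 (c%:MP : {mpoly rat[k + l]}).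
Proof.
move=> m; rewrite msuppC; case: ifP => // _; rewrite inE => /eqP ->.
by split; apply: big1 => i _; rewrite mnm0E.
Qed.

Lemma bidegree_sum k l a b (I : Type) (r : seq I) (F : I -> {mpoly rat[k + l]}) :
  (forall i, bidegree a b (F i)) -> bidegree a b (\sum_(i <- r) F i).
Proof.
move=> hF; apply: big_ind => [||i _]; [exact: bidegree0 | | exact: hF].
move=> P Q hP hQ m /msuppD_le.
by rewrite mem_cat => /orP[/hP|/hQ].
Qed.

Lemma bidegree_prod k l (I : Type) (r : seq I) (a b : I -> nat)
    (F : I -> {mpoly rat[k + l]}) :
  (forall i, bidegree (a i) (b i) (F i)) ->
  bidegree (\sum_(i <- r) a i) (\sum_(i <- r) b i) (\prod_(i <- r) F i).
Proof.
move=> hF; elim: r => [|i r IHr]; first by rewrite !big_nil; exact: bidegreeC.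
by rewrite !big_cons; apply: bidegreeM.
Qed.

Lemma bidegreeXl k l (i : 'I_k) : bidegree 1 0 ('X_(lshift l i) : {mpoly rat[k + l]}).
Proof.
move=> m; rewrite msuppX inE => /eqP ->; split.
  rewrite (bigD1 i) //= mnm1E eqxx big1 // => j ji.
  by rewrite mnm1E eq_lshift eq_sym (negPf ji).
by apply: big1 => j _; rewrite mnm1E eq_lrshift.
Qed.

Lemma bidegreeXr k l (i : 'I_l) : bidegree 0 1 ('X_(rshift k i) : {mpoly rat[k + l]}).
Proof.
move=> m; rewrite msuppX inE => /eqP ->; split.
  by apply: big1 => j _; rewrite mnm1E eq_rlshift.
rewrite (bigD1 i) //= mnm1E eqxx big1 // => j ji.
by rewrite mnm1E eq_rshift eq_sym (negPf ji).
Qed.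

(** The bidegree of an entry depends on its row only, so all terms of the Leibniz expansion share
    one bidegree. *)
Lemma bidegree_det k l r (a b : 'I_r -> nat) (A : 'M[{mpoly rat[k + l]}]_r) :
  (forall i j, bidegree (a i) (b i) (A i j)) ->
  bidegree (\sum_i a i) (\sum_i b i) (\det A).
Proof.
move=> hA; apply: bidegree_sum => s.
rewrite -[(\sum_i a i)%N]add0n -[(\sum_i b i)%N]add0n; apply: bidegreeM.
  by case: (perm.odd_perm s); rewrite /= ?expr1 ?expr0 -?mpolyC1 -?mpolyCN; exact: bidegreeC.
by apply: bidegree_prod.
Qed.

(** Each row is linear in the coefficients of one of the two forms, so the bidegree counts the
    selected rows of each kind. *)
Lemma bidegree_macaulay_minor d k C r (f : 'I_r -> 'I_(ncoef k + ncoef k))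
    (g : 'I_r -> 'I_(ncoef (d + k))) :
  bihomogeneous (\det (mxsub f g
    (macaulay C (fun i => 'X_i : {mpoly rat[ncoef d + ncoef d]})))).
Proof.
pose isl i : nat := if split (f i) is inl _ then 1%N else 0%N.
pose isr i : nat := if split (f i) is inl _ then 0%N else 1%N.
exists (\sum_i isl i)%N, (\sum_i isr i)%N; apply: bidegree_det => i j.
rewrite !mxE; case: ifP => _; last exact: bidegree0.
rewrite /macaulay_entry /isl /isr /coef_of; case: split => u; case: ifP => _;
  try exact: bidegree0; case: pickP => [x _|_]; try exact: bidegree0.
- exact: bidegreeXl.
- exact: bidegreeXr.
Qed.

Section Generic.
Variables k l : nat.
Implicit Types Q : ('I_(k + l) -> rat) -> Prop.

(** A single inequation is enough, because finite conjunctions are handled by multiplying the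
    polynomials. *)
Definition holds_generically Q := exists P : {mpoly rat[k + l]},
  [/\ bihomogeneous P, exists v, P.@[v] != 0 & forall v, P.@[v] != 0 -> Q v].

Lemma holds_generically_and Q1 Q2 : holds_generically Q1 -> holds_generically Q2 ->
  holds_generically (fun v => Q1 v /\ Q2 v).
Proof.
move=> [P1 [[a1 [b1 h1]] nz1 P1Q]] [P2 [[a2 [b2 h2]] nz2 P2Q]].
exists (P1 * P2); split; last 2 first.
- exact: nonvanishing_mul.
- by move=> v; rewrite mevalM mulf_eq0 negb_or => /andP[/P1Q ? /P2Q].
by exists (a1 + a2)%N, (b1 + b2)%N; exact: bidegreeM.
Qed.

Lemma holds_generically_all (I : eqType) (s : seq I) (Q : I -> ('I_(k + l) -> rat) -> Prop) :
  {in s, forall i, holds_generically (Q i)} ->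
  holds_generically (fun v => {in s, forall i, Q i v}).
Proof.
elim: s => [|i s IHs] hQ.
  exists 1; split=> //; last by exists (fun _ => 0); rewrite meval1 oner_eq0.
  by exists 0%N, 0%N; rewrite -mpolyC1; exact: bidegreeC.
have [||P [hP nzP PQ]] := @holds_generically_and (Q i) (fun v => {in s, forall i, Q i v}).
- exact/hQ/mem_head.
- by apply: IHs => j js; apply: hQ; rewrite inE js orbT.
exists P; split=> // v /PQ[Qi Qs] j; rewrite inE => /orP[/eqP ->|/Qs] //.
Qed.

End Generic.

(** The column sets used for stability depend on the term order and on the target monomial. There
    are only finitely many, and imposing all of them at once makes one open set serve every term
    order. *)
Lemma generic_max_rank d : holds_generically (k := ncoef d) (l := ncoef d) (fun v =>
  {in iota 0 d, forall k, {in enum {set 'I_(ncoef (d + k))}, forall C, forall w,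
    (\rank (@macaulay rat d k C w) <= \rank (@macaulay rat d k C v))%N}}).
Proof.
apply: holds_generically_all => k _; apply: holds_generically_all => C _.
pose A := macaulay (k := k) C (fun i => 'X_i : {mpoly rat[ncoef d + ncoef d]}).
have [r [f [g [nz maxr]]]] := max_minor A.
have evE v : map_mx (meval v) A = macaulay C v.
  rewrite macaulay_map; apply/matrixP => i j; rewrite !mxE; case: ifP => // _.
  rewrite /macaulay_entry; case: split => u; case: ifP => // _; rewrite /coef_of;
  by case: pickP => // x _; exact: mevalXU.
exists (\det (mxsub f g A)); split=> // [|v /maxr le_v w].
  exact: bidegree_macaulay_minor.
by have := le_v w; rewrite !evE.
Qed.

Lemma form_of_coef d (v : 'I_(ncoef d) -> rat) :
  exists2 f : {mpoly rat[3]}, f \is d.-homog & @coef_at d f =1 v.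
Proof.
exists (\sum_a v a *: 'X_[mon a]).
  by apply: rpred_sum => a _; apply: dhomogZ; rewrite dhomogX /= mdeg_mon.
move=> i; rewrite /coef_at raddf_sum (bigD1 i) //= big1 ?addr0 => [|b bi].
  by rewrite mcoeffZ mcoeffX eqxx mulr1.
by rewrite mcoeffZ mcoeffX (inj_eq (@mon_inj _)) (negPf bi) mulr0.
Qed.

Lemma generic_open d (Q : ('I_(ncoef d + ncoef d) -> rat) -> Prop) :
  holds_generically Q ->
  exists U, [/\ zariski_open d U, exists f g, [/\ is_form d f, is_form d g & U f g]
    & forall f g, is_form d f -> is_form d g -> U f g -> Q (@coef_pair d f g)].
Proof.
move=> [P [hP nzP PQ]].
exists (fun f g => P.@[@coef_pair d f g] != 0); split=> [||f g _ _ /PQ //].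
  exists (eq P); split=> [_ <- //|f g _ _]; split; first by exists P.
  by case=> _ <-.
(* The variables for one coefficient of each form enter the product below, so that both forms are
   nonzero at the chosen point. *)
have [i0 _] : exists i : 'I_(ncoef d), mon i = (U_(i1) *+ d)%MM.
  by apply: monP; rewrite mdegMn mdeg1 mul1n.
have nzX i : exists v, ('X_i : {mpoly rat[ncoef d + ncoef d]}).@[v] != 0.
  by exists (fun _ => 1); rewrite mevalXU oner_eq0.
have [v] := nonvanishing_mul (nonvanishing_mul nzP (nzX (lshift _ i0))) (nzX (rshift _ i0)).
rewrite !mevalM !mevalXU !mulf_eq0 !negb_or => /andP[/andP[Pv v1] v2].
have [f fd fE] := form_of_coef (fun i => v (lshift _ i)).
have [g gd gE] := form_of_coef (fun i => v (rshift _ i)).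
exists f, g; split.
- split=> //; apply: contraNneq v1 => f0; rewrite -fE f0 /coef_at mcoeff0 //.
- split=> //; apply: contraNneq v2 => g0; rewrite -gE g0 /coef_at mcoeff0 //.
rewrite (@meval_eq _ _ _ v) // => i; rewrite /coef_pair -[in RHS](splitK i).
by case: (split i) => a; rewrite ?fE ?gE.
Qed.

Lemma initial_ideal_generators (le : rel 'X_{1..3}) d (f g : {mpoly rat[3]}) :
  (0 < d)%N -> monomial_order le -> f \is d.-homog -> g \is d.-homog ->
  (forall k C w, (k < d)%N ->
    (\rank (@macaulay rat d k C w) <= \rank (@macaulay rat d k C (@coef_pair d f g)))%N) ->
  exists s, minimal_generators
      (initial_ideal le (ideal_gen (fun h : {mpoly rat[3]} => h = f \/ h = g))) s /\
    (d < size s)%N.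
Proof.
move=> d0 ord fd gd maxr.
have [s [us sL sdom anti]] := minimal_monomials (pair_lead le f g).
exists s; split; first exact: minimal_generators_initial.
have [a [b [c [abc ba cb ca]]]] := sorted_variables ord.
have stab i j : le U_(j)%MM U_(i)%MM -> stable_under d (pair_lead le f g) i j.
  by move=> leij k m kd dm Lm mj; apply: (pair_lead_stable ord fd gd _ dm) => // C w; exact: maxr.
apply: (@generator_count d (pair_lead le f g) a b c) => //.
- by move=> m u; exact: pair_leadD.
- by move=> m; exact: (pair_lead_mdeg fd gd).
- by move=> k kd T; apply: (pair_lead_count ord) => // w; exact: maxr.
- exact: stab.
- exact: stab.
exact: stab.
Qed.

(** * Reduction modulo 2 *)

Lemma natr_F2 n : n%:R = (odd n)%:R :> 'F_2.
Proof.
rewrite -[n in LHS]odd_double_half natrD -mul2n natrM.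
by rewrite (_ : 2%:R = 0 :> 'F_2) ?mul0r ?addr0 //; apply: val_inj.
Qed.

Lemma intr_F2 (z : int) : z%:~R = (odd `|z|%N)%:R :> 'F_2.
Proof.
case: z => n; first by rewrite -natr_F2.
rewrite NegzE mulrNz abszN absz_nat -pmulrn [in LHS]natr_F2.
by case: (odd n.+1); apply/eqP.
Qed.

Lemma logn2_eq0 n : (0 < n)%N -> (logn 2 n == 0%N) = odd n.
Proof.
move=> n0; rewrite -[odd n]negbK -dvdn2 -[_ == _]negbK -lt0n logn_gt0 mem_primes n0.
by [].
Qed.

Lemma val2_frac (a b : int) : a != 0 -> b != 0 ->
  val2 (a%:~R / b%:~R) = (logn 2 `|a|)%:Z - (logn 2 `|b|)%:Z.
Proof.
move=> a0 b0; set x := _ / _.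
have x0 : x != 0 by rewrite mulf_neq0 ?invr_eq0 ?intr_eq0.
have E : numq x * b = a * denq x.
  apply: (@intr_inj rat); rewrite !intrM numqE mulrAC; congr (_ * _).
  by rewrite divfK // intr_eq0.
have := congr1 (fun z : int => logn 2 `|z|) E.
rewrite !abszM !lognM ?absz_gt0 ?numq_eq0 ?denq_neq0 // /val2 => L; lia.
Qed.

Lemma val2_int (a : int) : a != 0 -> val2 a%:~R = (logn 2 `|a|)%:Z.
Proof. by move=> a0; rewrite -[a%:~R]divr1 (@val2_frac a 1) // logn1 subr0. Qed.

Lemma val2M x y : x != 0 -> y != 0 -> val2 (x * y) = val2 x + val2 y.
Proof.
move=> x0 y0; rewrite -[x in LHS]divq_num_den -[y in LHS]divq_num_den.
rewrite mulrACA -invfM -!intrM val2_frac ?mulf_neq0 ?numq_eq0 ?denq_neq0 //.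
rewrite !abszM !lognM ?absz_gt0 ?numq_eq0 ?denq_neq0 // /val2; lia.
Qed.

Lemma val2_pow2 (z : int) : val2 (2%:R ^ z) = z.
Proof.
case: z => n.
  rewrite -exprnP -natrX -[_%:R]/((2 ^ n)%N%:Z%:~R) val2_int.
    by rewrite absz_nat pfactorK.
  by rewrite eqz_nat expn_eq0.
rewrite NegzE -exprnN -natrX -[_%:R]/((2 ^ n.+1)%N%:Z%:~R) -[_^-1]mul1r.
rewrite (@val2_frac 1) // ?eqz_nat ?expn_eq0 // absz_nat pfactorK // logn1; lia.
Qed.

Lemma residue2_unit c : c != 0 -> val2 c = 0 -> residue2 c = 1.
Proof.
move=> c0; rewrite /val2 /residue2 => /eqP; rewrite subr_eq0 eqz_nat => /eqP E.
have n0 : (0 < `|numq c|)%N by rewrite absz_gt0 numq_eq0.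
have d0 : (0 < `|denq c|)%N by rewrite absz_gt0 denq_neq0.
suff on : odd `|numq c|.
  have od : odd `|denq c| by rewrite -logn2_eq0 // -E logn2_eq0.
  by rewrite !intr_F2 on od divr1.
(* Numerator and denominator have the same 2-adic order, so if one is even both are, against
   coprimality. *)
rewrite -[odd _]negbK -dvdn2; apply/negP => dn.
have dd : (2 %| `|denq c|)%N.
  by rewrite dvdn2 -logn2_eq0 // -E logn2_eq0 // -dvdn2.
have := dvdn_gcd 2 `|numq c| `|denq c|; rewrite dn dd.
by have /eqP -> := coprime_num_den c.
Qed.

Section Mod2.
Variable n : nat.

Definition red2 (H : {mpoly int[n]}) : {mpoly 'F_2[n]} := map_mpoly intr H.
Definition ratp (H : {mpoly int[n]}) : {mpoly rat[n]} := map_mpoly intr H.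

Lemma red2E H m : (red2 H)@_m = (odd `|H@_m|%N)%:R.
Proof. by rewrite mcoeff_map_mpoly /= intr_F2. Qed.

Lemma ratpE H m : (ratp H)@_m = (H@_m)%:~R.
Proof. by rewrite mcoeff_map_mpoly. Qed.

Lemma ratp0 : ratp 0 = 0. Proof. exact: raddf0. Qed.

Lemma ratpD H K : ratp (H + K) = ratp H + ratp K. Proof. exact: raddfD. Qed.

Lemma ratpM H K : ratp (H * K) = ratp H * ratp K. Proof. exact: rmorphM. Qed.

Lemma ratpZ c H : ratp (c *: H) = c%:~R *: ratp H. Proof. exact: map_mpolyZ. Qed.

Lemma ratpX m : ratp 'X_[m] = 'X_[m]. Proof. exact: map_mpolyX. Qed.

Lemma red20 : red2 0 = 0. Proof. exact: raddf0. Qed.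

Lemma red2D H K : red2 (H + K) = red2 H + red2 K. Proof. exact: raddfD. Qed.

Lemma red2B H K : red2 (H - K) = red2 H - red2 K. Proof. exact: raddfB. Qed.

Lemma red2M H K : red2 (H * K) = red2 H * red2 K. Proof. exact: rmorphM. Qed.

Lemma red2Z c H : red2 (c *: H) = c%:~R *: red2 H. Proof. exact: map_mpolyZ. Qed.

Lemma red2X m : red2 'X_[m] = 'X_[m]. Proof. exact: map_mpolyX. Qed.

Lemma ratp_inj : injective ratp.
Proof.
move=> H H' E; apply/mpolyP => m; apply: (@intr_inj rat).
by rewrite -!ratpE E.
Qed.

Lemma min_val2_eq (h : {mpoly rat[n]}) v : h != 0 ->
  {in msupp h, forall m, v <= val2 h@_m} ->
  (exists2 m, m \in msupp h & val2 h@_m = v) -> min_val2 h = v.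
Proof.
move=> h0 lev [m mh mv]; apply/eqP; rewrite eq_le /min_val2; apply/andP; split.
  elim: (msupp h) mh => // m' s IHs; rewrite inE big_cons ge_min.
  by case/orP=> [/eqP <-|/IHs ->]; rewrite ?mv ?lexx ?orbT.
rewrite big_seq; apply: (big_ind (fun x => v <= x)) => [|x y vx vy|m' /lev //].
  by apply: lev; exact: mlead_supp.
by rewrite le_min vx.
Qed.

(* Units of the localization at 2 all have residue 1, so the initial form of [h]
   is the reduction of any primitive integral multiple of [h]. *)
Lemma in0E (h : {mpoly rat[n]}) (c : rat) H :
  c != 0 -> c *: h = ratp H -> red2 H != 0 -> in0 h = red2 H.
Proof.
move=> c0 hH H0.
have hE m : c * h@_m = (H@_m)%:~R by rewrite -mcoeffZ hH ratpE.
have suppE m : (h@_m != 0) = (H@_m != 0).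
  by rewrite -[H@_m == 0](intr_eq0 rat) -hE mulf_eq0 (negPf c0).
have valE m : h@_m != 0 -> val2 h@_m = (logn 2 `|H@_m|)%:Z - val2 c.
  move=> hm; have := val2M c0 hm; rewrite hE val2_int -?suppE // => ->; lia.
have h0 : h != 0.
  apply: contraNneq H0 => h0; apply/eqP/mpolyP => m; rewrite red2E mcoeff0.
  have := suppE m; rewrite h0 mcoeff0 eqxx => /esym/negbFE/eqP ->.
  by [].
(* Since [red2 H] is nonzero, [H] has an odd coefficient, which attains the minimum. *)
have minE : min_val2 h = - val2 c.
  apply: min_val2_eq => // [m|]; first by rewrite mcoeff_msupp => /valE ->; lia.
  move: H0; rewrite -msupp_eq0; case E: (msupp _) => [//|m s] _.
  have : m \in msupp (red2 H) by rewrite E mem_head.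
  rewrite mcoeff_msupp red2E; case o: odd => // _.
  have Hm : H@_m != 0 by apply: contraTneq o => ->.
  exists m; first by rewrite mcoeff_msupp suppE.
  rewrite valE ?suppE //; move: o; rewrite -logn2_eq0 ?absz_gt0 // => /eqP ->; lia.
apply/mpolyP => m; rewrite red2E /in0 raddf_sum /=.
have termE m' : m' \in msupp h ->
    residue2 (2%:R ^ (- val2 h@_m') * h@_m') = 1.
  rewrite mcoeff_msupp => hm; have p0 z : (2%:R : rat) ^ z != 0 by rewrite expfz_neq0.
  apply: residue2_unit; rewrite ?mulf_neq0 //.
  by rewrite val2M // val2_pow2 addNr.
have oddE : h@_m != 0 -> (val2 h@_m == min_val2 h) = odd `|H@_m|.
  move=> hm; rewrite minE valE // -logn2_eq0 ?absz_gt0 -?suppE //.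
  by apply/eqP/eqP; lia.
case: (boolP (m \in msupp h)) => mh.
  rewrite big_mkcond (bigD1_seq m) ?msupp_uniq //= big1_seq ?addr0.
    rewrite -oddE -?mcoeff_msupp //; case: ifP => // _.
    by rewrite mcoeffZ mcoeffX eqxx mulr1 termE.
  move=> m' /andP[ne _]; case: ifP => // _.
  by rewrite mcoeffZ mcoeffX (negPf ne) mulr0.
rewrite big_seq_cond big1 => [|m' /andP[m'h _]].
  by move: mh; rewrite mcoeff_msupp suppE negbK => /eqP ->.
rewrite mcoeffZ mcoeffX; case: eqP => [E|]; rewrite ?mulr0 //.
by rewrite -E m'h in mh.
Qed.

Lemma clear_denominators (h : {mpoly rat[n]}) :
  exists2 N : int, N != 0 & exists H, N%:~R *: h = ratp H.
Proof.
rewrite [h]mpolyE; apply: (big_ind (fun p => exists2 N : int, N != 0 &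
  exists H, N%:~R *: p = ratp H)) => [|x y|m _].
- by exists 1 => //; exists 0; rewrite scaler0 ratp0.
- move=> [N N0 [H HE]] [M M0 [K KE]]; exists (N * M); first by rewrite mulf_neq0.
  exists (M *: H + N *: K); rewrite ratpD !ratpZ -HE -KE.
  by rewrite scalerDr !scalerA !intrM [M%:~R * _]mulrC.
exists (denq h@_m); first exact: denq_neq0.
by exists (numq h@_m *: 'X_[m]); rewrite ratpZ ratpX scalerA numqE mulrC.
Qed.

Lemma red2_eq0 H : red2 H = 0 -> exists K, H = 2 *: K.
Proof.
move=> H0; rewrite [H]mpolyE; apply: (big_ind (fun p => exists K, p = 2 *: K)) => [|x y [K ->] [L ->]|m _].
- by exists 0; rewrite scaler0.
- by exists (K + L); rewrite scalerDr.
have : ~~ odd `|H@_m|.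
  by have := red2E H m; rewrite H0 mcoeff0; case: odd.
rewrite -dvdn2 => /dvdnP[k kE].
exists ((sgz H@_m * k%:Z) *: 'X_[m]); rewrite scalerA; congr (_ *: _).
by rewrite [LHS]intEsg -mulrCA; congr (_ * _); rewrite kE PoszM mulrC.
Qed.

Lemma red2_surj (r : {mpoly 'F_2[n]}) : exists H, red2 H = r.
Proof.
rewrite [r]mpolyE; apply: (big_ind (fun p => exists H, red2 H = p)) => [|x y [K <-] [L <-]|m _].
- by exists 0; rewrite red20.
- by exists (K + L); rewrite red2D.
exists ((r@_m : nat)%:Z *: 'X_[m]); rewrite red2Z red2X.
by congr (_ *: _); exact: natr_Zp.
Qed.

Lemma red2_scale_odd (o : int) H : odd `|o| -> red2 (o *: H) = red2 H.
Proof. by move=> oo; rewrite red2Z intr_F2 oo scale1r. Qed.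

(** Divide by 2 while the reduction vanishes; the 2-adic order of one fixed nonzero coefficient
    bounds the number of divisions. *)
Lemma primitive_part (H : {mpoly int[n]}) : H != 0 ->
  exists k K, H = (2 ^+ k : int) *: K /\ red2 K != 0.
Proof.
move=> H0; have [m mH] : exists m, H@_m != 0.
  move: H0; rewrite -msupp_eq0; case E: (msupp H) => [//|m s] _; exists m.
  by rewrite -mcoeff_msupp E mem_head.
have [N] := ubnP (logn 2 `|H@_m|); elim: N H mH {H0} => // N IHN H mH lt_N.
case: (classic (red2 H = 0)) => [/red2_eq0[K HE]|/eqP rH]; last first.
  by exists 0%N, H; rewrite expr0 scale1r; split.
have KE : H@_m = 2 * K@_m by rewrite HE mcoeffZ.
have mK : K@_m != 0 by apply: contraNneq mH => K0; rewrite KE K0 mulr0.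
have [|k [L [LE rL]]] := IHN K mK.
  by move: lt_N; rewrite KE abszM lognM ?absz_gt0 //; rewrite (_ : logn 2 `|2%Z| = 1%N).
by exists k.+1, L; rewrite exprS -scalerA HE LE.
Qed.

Lemma primitive_multiple (h : {mpoly rat[n]}) : h != 0 ->
  exists2 c, c != 0 & exists H, c *: h = ratp H /\ red2 H != 0.
Proof.
move=> h0; have [N N0 [H HE]] := clear_denominators h.
have H0 : H != 0.
  apply: contraNneq h0 => H0; move: HE; rewrite H0 ratp0 => /eqP.
  by rewrite scaler_eq0 intr_eq0 (negPf N0).
have [k [K [KE rK]]] := primitive_part H0.
have p0 : (2 ^+ k : rat) != 0 by rewrite expf_neq0.
exists (N%:~R / 2 ^+ k); first by rewrite mulf_neq0 ?invr_eq0 ?intr_eq0.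
exists K; split=> //; rewrite mulrC -scalerA HE KE ratpZ rmorphXn /=.
by rewrite scalerA mulVf ?scale1r.
Qed.

(** The two monomials share no variable. Comparing coefficients at [m + u] shows that [x^v] divides
    every term of [p], so every syzygy is a Koszul one. *)
Lemma monomial_syzygy (F : fieldType) (u v : 'X_{1..n}) (p q : {mpoly F[n]}) :
  (forall i, u i = 0%N \/ v i = 0%N) -> p * 'X_[u] + q * 'X_[v] = 0 ->
  exists r, p = r * 'X_[v] /\ q = - (r * 'X_[u]).
Proof.
move=> uv E; have vp m : m \in msupp p -> (v <= m)%MM.
  rewrite mcoeff_msupp => pm.
  have := congr1 (mcoeff (m + u)%MM) E; rewrite mcoeffD mcoeff0.
  rewrite ![_ * 'X_[_]]mulrC !mcoeff_mulX lem_addl addmK;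
  case: ifP => [le_v _|_]; last first.
    by rewrite addr0 => /eqP; rewrite (negPf pm).
  apply/mnm_lepP => i; move/mnm_lepP/(_ i): le_v; rewrite mnmDE.
  by case: (uv i) => ->; rewrite ?addn0.
pose r := \sum_(m <- msupp p) p@_m *: 'X_[m - v].
have pE : p = r * 'X_[v].
  rewrite [LHS]mpolyE mulr_suml; apply: eq_big_seq => m /vp le_v.
  by rewrite -scalerAl -mpolyXD submK.
exists r; split=> //; have Xv0 : 'X_[v] != 0 :> {mpoly F[n]}.
  by rewrite -msupp_eq0 msuppX.
apply: (mulIf Xv0); move: E; rewrite pE mulrAC mulNr => /eqP.
by rewrite addrC addr_eq0 => /eqP.
Qed.

(* If [k > 0], then [(P, Q)] is a syzygy of [(x^u, x^v)] modulo 2; subtracting a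
   multiple of the Koszul syzygy [(G, - F)] makes both divisible by 2. *)
Lemma red2_in_monomial_ideal (u v : 'X_{1..n}) F G k P Q H :
  (forall i, u i = 0%N \/ v i = 0%N) -> red2 F = 'X_[u] -> red2 G = 'X_[v] ->
  (2 ^+ k : int) *: H = P * F + Q * G ->
  exists a b, red2 H = a * 'X_[u] + b * 'X_[v].
Proof.
move=> uv rF rG; elim: k P Q => [|k IHk] P Q E.
  exists (red2 P), (red2 Q); rewrite -rF -rG.
  by move: E; rewrite expr0 scale1r => ->; rewrite red2D !red2M.
have : red2 P * 'X_[u] + red2 Q * 'X_[v] = 0.
  have := congr1 red2 E; rewrite red2D !red2M rF rG => <-.
  by rewrite red2Z intr_F2 abszX oddX /= scale0r.
case/(monomial_syzygy uv) => r [rP rQ].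
have [R RE] := red2_surj r.
have [P1 P1E] : exists P1, P - R * G = 2 *: P1.
  by apply: red2_eq0; rewrite red2B red2M rP RE rG subrr.
have [Q1 Q1E] : exists Q1, Q + R * F = 2 *: Q1.
  by apply: red2_eq0; rewrite red2D red2M rQ RE rF addNr.
apply: (IHk P1 Q1).
have two0 : (2 : int) != 0 by [].
apply/mpolyP => m; apply: (mulfI two0); rewrite -!mcoeffZ; congr (mcoeff m _).
rewrite scalerA -exprS E scalerDr !scalerAl -P1E -Q1E.
by rewrite !mulrDl addrACA mulNr [R * F * G]mulrAC addNr addr0.
Qed.

Lemma in0_pair_ideal (u v : 'X_{1..n}) (f g : {mpoly rat[n]}) (c1 c2 : rat) F G :
  (forall i, u i = 0%N \/ v i = 0%N) -> c1 != 0 -> c2 != 0 ->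
  c1 *: f = ratp F -> c2 *: g = ratp G -> red2 F = 'X_[u] -> red2 G = 'X_[v] ->
  forall q, in0_ideal (ideal_gen (fun h => h = f \/ h = g)) q <->
    ideal_gen (fun h => h = 'X_[u] \/ h = 'X_[v]) q.
Proof.
move=> uv c10 c20 fF gG rF rG q.
have X0 w : 'X_[w] != 0 :> {mpoly 'F_2[n]} by rewrite -msupp_eq0 msuppX.
have in0f : in0 f = 'X_[u] by rewrite -rF; apply: in0E fF _; rewrite ?rF.
have in0g : in0 g = 'X_[v] by rewrite -rG; apply: in0E gG _; rewrite ?rG.
have nz (h : {mpoly rat[n]}) c K : c *: h = ratp K -> red2 K != 0 -> h != 0.
  move=> hK; apply: contraNneq => h0; move: hK; rewrite h0 scaler0 => /esym.
  by rewrite -ratp0 => /ratp_inj ->; apply/eqP; exact: red20.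
have f0 : f != 0 by apply: nz fF _; rewrite rF.
have g0 : g != 0 by apply: nz gG _; rewrite rG.
split=> [[s [sG ->]] | [s [sG ->]]]; last first.
  exists s; split=> // h /sG[] ->.
    by exists f; split=> //; apply/ideal_pairP; exists 1, 0; rewrite mul1r mul0r addr0.
  by exists g; split=> //; apply/ideal_pairP; exists 0, 1; rewrite mul1r mul0r add0r.
rewrite big_seq; apply/ideal_pairP.
apply: (big_ind (fun p => exists a b, p = a * 'X_[u] + b * 'X_[v])) => [||x /sG].
- by exists 0, 0; rewrite !mul0r addr0.
- by move=> x y [a [b ->]] [a' [b' ->]]; exists (a + a'), (b + b'); rewrite !mulrDl addrACA.
case=> h [/ideal_pairP[a [b hE]] h0 ->].
have [c c0 [H [HE rH]]] := primitive_multiple h0.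
rewrite (in0E c0 HE rH).
suff [a' [b' ->]] : exists a b, red2 H = a * 'X_[u] + b * 'X_[v].
  by exists (x.1 * a'), (x.1 * b'); rewrite mulrDr !mulrA.
(* Clearing denominators gives an integral relation with [N * M] in front of [H]. Its odd part and
   sign do not change the reduction, so they are absorbed into [H] and a power of 2 remains. *)
have [N N0 [P PE]] := clear_denominators ((c / c1) *: a).
have [M M0 [Q QE]] := clear_denominators ((c / c2) *: b).
have NM0 : (0 < `|(N * M)%R|)%N by rewrite absz_gt0 mulf_neq0.
have [o oo oE] := pfactor_coprime (isT : prime 2) NM0.
have intE : (N * M) *: H = (M *: P) * F + (N *: Q) * G.
  apply: ratp_inj; rewrite ratpD !ratpM !ratpZ -HE -PE -QE -fF -gG.
  rewrite hE /= !scalerDr -!scalerAl -!scalerAr !scalerA intrM; congr (_ *: _ + _ *: _).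
    by rewrite -[RHS]mulrA divfK // [M%:~R * _]mulrC.
  by rewrite -[RHS]mulrA divfK.
pose k := logn 2 `|(N * M)%R|.
rewrite -(@red2_scale_odd ((-1) ^+ (N * M < 0)%R * o%:Z)); last first.
  by rewrite abszMsign absz_nat -coprime2n.
apply: (red2_in_monomial_ideal (k := k) uv rF rG (P := M *: P) (Q := N *: Q)).
rewrite -intE scalerA; congr (_ *: _).
rewrite [RHS]intEsign oE PoszM mulrCA; congr (_ * _).
by rewrite mulrC; congr (_ * _); rewrite -[RHS]natz natrX.
Qed.

Lemma unit_form_reduction d (f : {mpoly rat[n]}) u : f \is d.-homog ->
  (forall m : 'X_{1..n}, mdeg m = d -> m <> u -> val2_pos f@_m) ->
  val2_zero f@_u ->
  exists2 c, c != 0 & exists F, c *: f = ratp F /\ red2 F = 'X_[u].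
Proof.
move=> fd fpos [fu0 fu].
have f0 : f != 0 by apply: contraNneq fu0 => ->; rewrite mcoeff0.
have [c c0 [F [FE rF]]] := primitive_multiple f0; exists c => //; exists F; split=> //.
have hE m : c * f@_m = (F@_m)%:~R by rewrite -mcoeffZ FE ratpE.
have suppE m : (f@_m != 0) = (F@_m != 0).
  by rewrite -[F@_m == 0](intr_eq0 rat) -hE mulf_eq0 (negPf c0).
have valE m : f@_m != 0 -> (logn 2 `|F@_m|)%:Z = val2 c + val2 f@_m.
  by move=> hm; rewrite -val2M // hE val2_int -?suppE.
have pos m : m <> u -> f@_m != 0 -> 0 < val2 f@_m.
  move=> mu fm; apply: fpos => //; apply: (dhomog_mf fd).
  by rewrite mcoeff_msupp.
have Fu := valE u fu0.
(* Some coefficient of [F] is odd. At a monomial other than [u] this would make [val2 c] negative,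
   and then the integer [F@_u] would have negative valuation. *)
have vc : val2 c = 0.
  move: rF; rewrite -msupp_eq0; case E: (msupp _) => [//|m s] _.
  have : m \in msupp (red2 F) by rewrite E mem_head.
  rewrite mcoeff_msupp red2E; case o: odd => // _.
  have Fm : F@_m != 0 by apply: contraTneq o => ->.
  move: o; rewrite -logn2_eq0 ?absz_gt0 // => /eqP o.
  have fm : f@_m != 0 by rewrite suppE.
  have := valE m fm; rewrite o; case: (eqVneq m u) => [-> |/eqP mu].
    by rewrite fu; lia.
  by have := pos m mu fm; move: Fu; rewrite fu; lia.
apply/mpolyP => m; rewrite red2E mcoeffX.
case: (eqVneq u m) => [<-|um].
  rewrite -logn2_eq0 ?absz_gt0 -?suppE //.
  by have := Fu; rewrite fu vc addr0 => -[->].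
case: (eqVneq F@_m 0) => [-> //|Fm].
have fm : f@_m != 0 by rewrite suppE.
rewrite -logn2_eq0 ?absz_gt0 //; have := pos m (fun E => negP um (introT eqP (esym E))) fm.
by have := valE m fm; rewrite vc add0r => <-; case: logn.
Qed.

End Mod2.

Theorem theorem5p2 (d e : nat) (d_gt0 : (0 < d)%N) (d_eq : d = (2 * e)%N) :
  exists U : {mpoly rat[3]} -> {mpoly rat[3]} -> Prop,
    zariski_open d U /\
    (exists f g, [/\ is_form d f, is_form d g & U f g]) /\
    forall f g : {mpoly rat[3]},
      is_form d f -> is_form d g -> U f g ->
      (forall m : 'X_{1..3}, mdeg m = d -> m <> (U_(i1) *+ d)%MM ->
         val2_pos f@_m) ->
      (forall m : 'X_{1..3}, mdeg m = d -> m <> (U_(i2) *+ e + U_(i3) *+ e)%MM ->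
         val2_pos g@_m) ->
      val2_zero f@_(U_(i1) *+ d) ->
      val2_zero g@_(U_(i2) *+ e + U_(i3) *+ e) ->
      let I := ideal_gen (fun h : {mpoly rat[3]} => h = f \/ h = g) in
      (forall q : {mpoly 'F_2[3]},
         in0_ideal I q <->
         ideal_gen (fun h : {mpoly 'F_2[3]} =>
           h = 'X_i1 ^+ d \/ h = 'X_i2 ^+ e * 'X_i3 ^+ e) q) /\
      (forall le : rel 'X_{1..3}, monomial_order le ->
         exists s : seq 'X_{1..3},
           minimal_generators (initial_ideal le I) s /\
           (d%:R + 3%:R) / 2%:R <= (size s)%:R :> rat).
Proof.
have [U [openU neU Umax]] := generic_open (generic_max_rank d).
exists U; split=> //; split=> // f g ff gf Ufg fpos gpos fu gv I.
have [[_ fd] [_ gd]] := (ff, gf); split; last first.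
  move=> le ord; have [k C w kd|s [mins sz]] := initial_ideal_generators d_gt0 ord fd gd.
    by apply: (Umax f g ff gf Ufg); rewrite ?mem_iota ?mem_enum.
  (* The bound [d + 1 <= size s] suffices, as [d + 3 <= 2 (d + 1)] for positive [d]. *)
  exists s; split=> //; rewrite ler_pdivrMr ?ltr0n // -natrD -natrM ler_nat; lia.
have [c1 c10 [F [fF rF]]] := unit_form_reduction fd fpos fu.
have [c2 c20 [G [gG rG]]] := unit_form_reduction gd gpos gv.
have uv (i : 'I_3) : (U_(i1) *+ d)%MM i = 0%N \/ (U_(i2) *+ e + U_(i3) *+ e)%MM i = 0%N.
  rewrite mnmDE !mulmnE !mnm1E.
  by case: i => -[|[|[|//]]] lti; [right | left | left].
move=> q; apply: (iff_trans (in0_pair_ideal uv c10 c20 fF gG rF rG q)).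
by rewrite mpolyXD !mpolyXn.
Qed.
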